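(* Assume the setting and Assumptions A1--A3 of the context with $p\ge3$. Assume further that, as $M\to\infty$, (a) $\max_{j=0,1}|x_{j,M}-x_{j,\delta}|=o(M^{-1})$ (a.s.) and (b) $\min\{x_{1,M}-x_{1,\delta},\;x_{0,\delta}-x_{0,M}\}\gg M^{-3/2}$. Then (a.s.) $$\|G_*^{-1}\|=O(M^2),$$ where $\|\cdot\|$ is the operator norm and $$G_*:=\mathbb E\left(X^{\boldsymbol\beta}(\tilde T_1;\boldsymbol\beta^* )\,\big(X^{\boldsymbol\beta}(\tilde T_1;\boldsymbol\beta^* )\big)^T\right).$$
   Context: Notation: $a_M\gg b_M$ means $b_M/a_M\to0$. $\delta\in(0,1/2)$ is a fixed small constant. $X=X_g$ solves $X'(t)=g(X(t))$, $t\in[0,1]$, $X(0)=x_0$, with $g$ smooth and positive. Put $x_1=X(1)$, $x_{0,\delta}=X(\delta)$, $x_{1,\delta}=X(1-\delta)$. For each $M$, $x_{0,M}<x_{1,M}$ are given endpoints (in the application they are data dependent, computed from an independent sample, which is why the statement is ''a.s.''; they may be treated as nonrandom sequences), and $D_0=[x_{0,M},x_{1,M}]$. For basis functions $\phi_{1,M},\dots,\phi_{M,M}$ on $D_0$ and $\boldsymbol\beta\in\mathbb R^M$, $g_{\boldsymbol\beta}=\sum_{k=1}^M\beta_k\phi_{k,M}$. $X(t;\boldsymbol\beta)$ denotes the solution of $x'(t)=g_{\boldsymbol\beta}(x(t))$, $t\in[\delta,1-\delta]$, $x(\delta)=x_{0,\delta}$, and $X^{\boldsymbol\beta}(t;\boldsymbol\beta)\in\mathbb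 R^M$ is its gradient with respect to $\boldsymbol\beta$. Assumptions. A1: $g\in C^p(D)$ and $g>0$ on $D$, where $D$ is an open interval containing $[x_0,x_1]$ and $p$ is an integer. A2: (i) each $\phi_{k,M}$ has unit $L^2$ norm; (ii) the combined support of $\{\phi_{k,M}\}_{k=1}^M$ is $D_0$ and each $\phi_{k,M}$ has support of length $O(M^{-1})$; (iii) $\phi_{k,M}\in C^2(D_0)$; (iv) $\sup_{x\in D_0}\sum_{k=1}^M|\phi_{k,M}^{(j)}(x)|^2=O(M^{1+2j})$, $j=0,1,2$; (v) the eigenvalues of the Gram matrix $\big(\int_{D_0}\phi_{k,M}\phi_{l,M}\big)_{k,l}$ lie in $[\underline c,\overline c]$ for constants $0<\underline c\le\overline c<\infty$ not depending on $M$; (vi) for every $M$ there is $\boldsymbol\beta^*\in\mathbb R^M$ with $\sup_{t\in[\delta,1-\delta]}|X_g(t)-X(t;\boldsymbol\beta^* )|=O(M^{-(p+1)})$ and $\sup_{u\in[x_{0,\delta},x_{1,\delta}]}|g^{(j)}(u)-g^{(j)}_{\boldsymbol\beta^*}(u)|=O(M^{-p+j})$, $j=0,1,2$. The vector $\boldsymbol\beta^*$ in the claim is the one in (vi). A3: the observation times $T_j$ are i.i.d. on $[0,1]$ with density $f_T$ satisfying $\underline c'\le f_T\le\overline c'$ for some $0<\underline c'\le\overline c'<\infty$. $\tilde T_1$ has the distribution of $T_1$ conditional on $T_1\in[\delta,1-\delta]$; the expectation in $G_*$ is with respect to $\tilde T_1$. *)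

(* Defs.v *)
From HB Require Import structures.
From mathcomp Require Import all_boot all_order all_algebra.
From mathcomp Require Import all_classical all_reals all_analysis.
Import Order.TTheory GRing.Theory Num.Theory numFieldNormedType.Exports.

Set Implicit Arguments.
Unset Strict Implicit.
Unset Printing Implicit Defensive.

Local Open Scope ring_scope.
Local Open Scope classical_set_scope.

Section calculus_on_sets.
Context {R : realType}.
Implicit Types (A : set R) (f x : R -> R).

(* Difference quotients at [u] along points of [A]: one-sided at an endpoint
   of a closed interval, so that the values of [f] outside [A] never matter. *)
Definition quot_within A f (u : R) : set_system R :=
  (f s - f u) / (s - u) @[s --> within A u^'].

Definition derive_within A f : R -> R := fun u => lim (quot_within A f u).

Definition deriven_within A (j : nat) f : R -> R := iter j (derive_within A) f.

Definition class_C_within A (n : nat) f : Prop :=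
  (forall j, (j < n)%N ->
     forall u, A u -> cvg (quot_within A (deriven_within A j f) u)) /\
  {within A, continuous (deriven_within A n f)}.

(* On an open set the two-sided derivatives of the library are used. *)
Definition class_C_open A (n : nat) f : Prop :=
  (forall j, (j < n)%N -> forall u, A u -> derivable f^`(j) u 1) /\
  (forall u, A u -> {for u, continuous f^`(n)}).

(* x' = f(x) on [I], for a right-hand side [f] which is only meaningful on
   [A]: being a solution includes staying inside [A]. *)
Definition ode_solution (I A : set R) f x : Prop :=
  forall t, I t -> A (x t) /\ quot_within I x t --> f (x t).

Definition supp_in A f : set R := closure [set u | A u /\ f u != 0].

Definition L2norm_on A f : R :=
  Num.sqrt (\int[lebesgue_measure]_(u in A) (f u ^+ 2)).

Definition gram A (M : nat) (phi : 'I_M -> R -> R) : 'M[R]_M :=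
  \matrix_(k, l) \int[lebesgue_measure]_(u in A) (phi k u * phi l u).

(* sup_(u in A M) |f M u| = O(r M) as M -> oo *)
Definition sup_bigO (T : Type) (A : nat -> set T) (f : nat -> T -> R)
    (r : nat -> R) : Prop :=
  exists C : R, \forall M \near \oo, forall u, A M u -> `|f M u| <= C * r M.

End calculus_on_sets.

Section operator_norm.
Context {R : realType}.

(* The library norm on matrices is the entrywise maximum. *)
Definition enorm n (v : 'cV[R]_n) : R := Num.sqrt (\sum_i v i ord0 ^+ 2).

Definition opnorm n (A : 'M[R]_n) : R :=
  sup [set enorm (A *m v) | v in [set v : 'cV[R]_n | enorm v <= 1]].

End operator_norm.

Section parametric_ode.
Context {R : realType}.
Variables (M : nat) (phi : 'I_M -> R -> R).
Implicit Types beta : 'cV[R]_M.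

Definition gbeta beta : R -> R := fun u => \sum_(k < M) beta k ord0 * phi k u.

Variables (D0 : set R) (delta x0d : R).

Definition is_traj beta (x : R -> R) : Prop :=
  ode_solution `[delta, 1 - delta] D0 (gbeta beta) x /\ x delta = x0d.

(* X(.;beta) is set to 0 outside [delta, 1 - delta]; it is a junk value when
   no solution exists (when one exists it is unique for C^1 functions [phi k]). *)
Definition traj beta : R -> R :=
  (xget (cst 0) [set x | is_traj beta x]) \_ `[delta, 1 - delta].

(* Partial derivatives of X(t;.) at beta. *)
Definition traj_grad beta (t : R) : 'cV[R]_M :=
  \col_k (fun h : R => traj (beta + h *: delta_mx k ord0) t)^`() 0.

Definition Gstar d (Omega : measurableType d) (P : probability Omega R)
    (T : Omega -> R) beta : 'M[R]_M :=
  \matrix_(k, l)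
    fine ('E_P[fun w => (traj_grad beta (T w) *m (traj_grad beta (T w))^T) k l])%E.

End parametric_ode.

Section random_times.
Context {R : realType} d (Omega : measurableType d) (P : probability Omega R).

(* Product rule over arbitrary measurable sets; subfamilies are covered by
   taking the remaining sets to be [setT]. *)
Definition mutually_independent (n : nat) (T : 'I_n -> {RV P >-> R}) : Prop :=
  forall B : 'I_n -> set R, (forall j, measurable (B j)) ->
    (P (\bigcap_(j in [set: 'I_n]) (T j @^-1` B j)) =
     \prod_(j < n) P (T j @^-1` B j))%E.

Definition has_density_on (A : set R) (T : {RV P >-> R}) (f : R -> R) : Prop :=
  measurable_fun A f /\
  forall B : set R, measurable B ->
    (distribution P T B = \int[lebesgue_measure]_(u in B `&` A) (f u)%:E)%E.

End random_times.

Definition has_cond_law {R : realType} d (Omega : measurableType d)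
    (P : probability Omega R) (T : {RV P >-> R}) (A : set R)
    d' (Omega' : measurableType d') (P' : probability Omega' R)
    (T' : {RV P' >-> R}) : Prop :=
  forall B : set R, measurable B ->
    fine (distribution P' T' B) =
    fine (distribution P T (B `&` A)) / fine (distribution P T A).

(* Main.v *)
(* Along the trajectory [y] of [g_* = gbeta bstar] the k-th partial derivative of
   [X(t; .)] is [g_*(y t)] times the integral of [phi_k / g_*^2] from
   [X delta] to [y t].  Hence, with [h = sum_k a_k phi_k], [q = h / g_*^2] and
   [H] the primitive of [q] vanishing at [X delta], the form [a^T G_* a]
   dominates a multiple of [int_I H^2], where [I] fills [D_0] up to length
   [o(1/M)].  The Gram bound gives [int_I q^2 >= c |a|^2]; the short supports of
   the [phi_k] give [int_I q^2 = O(|a|^2)] and [int_I q'^2 = O(M^2 |a|^2)].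
   Interpolating [q = H'] between [H] and [q'] yields
   [int_I H^2 >= c M^-2 |a|^2]. *)
Require Import Defs.

From HB Require Import structures.
From mathcomp Require Import all_boot all_order all_algebra.
From mathcomp Require Import all_classical all_reals all_analysis.
From mathcomp Require Import ring lra measurable_realfun.
Import Order.TTheory GRing.Theory Num.Theory numFieldNormedType.Exports.

Set Implicit Arguments.
Unset Strict Implicit.
Unset Printing Implicit Defensive.

Local Open Scope ring_scope.
Local Open Scope classical_set_scope.

(** * Derivatives along a set *)

Section calculus.
Context {R : realType}.
Implicit Types (f g x : R -> R) (a b u l : R) (A : set R).

(** The gradient in [beta] is explicit because the equation is scalar and autonomous: a primitive of
    [1 / g_*], evaluated along the trajectory, is time, so replacing [g_*] by [g_* + h phi_k] only
    changes an integrand. The obstacle is that trajectories exist only inside [D_0], where the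
    [phi_k] live. Condition (b) makes the margins of [D_0] beyond [X delta] and [X (1 - delta)]
    large against [M^-2], hence against the error of the trajectory of [g_*]; so this trajectory
    ends strictly inside [D_0] and slightly perturbed ones stay there. Condition (a) works in the
    opposite direction: the Gram bound concerns all of [D_0], while the time integral sees only the
    range of the trajectory; as [sum_k phi_k^2 = O(M)], dropping a length [o(1/M)] costs
    [o(1) |a|^2]. The primitive [H] vanishes only at the left end of [I], so the interpolation also
    needs [q(b)^2 = O(M |a|^2)] at the right end [b]. A primitive of a function varying at scale
    [1/M] may lose a factor [M]; its square is the [M^2] of the claim. *)

Lemma quot_withinP A f u l : quot_within A f u --> l <->
  forall e : R, 0 < e -> exists2 d : R, 0 < d & forall s, A s -> `|s - u| < d ->
    `|f s - f u - l * (s - u)| <= e * `|s - u|.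
Proof.
split=> [/cvgrPdist_le fl e e0|H].
  have [d /= d0 Hd] := fl e e0.
  exists d => // s As sd; have [->|su] := eqVneq s u.
    by rewrite !subrr mulr0 subrr normr0 mulr0.
  have := Hd s; rewrite /= distrC => /(_ sd su As).
  have su0 : s - u != 0 by rewrite subr_eq0.
  have -> : f s - f u - l * (s - u) = - ((l - (f s - f u) / (s - u)) * (s - u)).
    by field.
  by rewrite normrN normrM; apply: ler_wpM2r.
apply/cvgrPdist_le => e e0; have [d d0 Hd] := H e e0.
exists d => //= s; rewrite /= distrC => sd su As.
have su0 : s - u != 0 by rewrite subr_eq0.
have -> : l - (f s - f u) / (s - u) = - ((f s - f u - l * (s - u)) / (s - u)).
  by field.
by rewrite normrN normrM normfV ler_pdivrMr ?normr_gt0// Hd.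
Qed.

(** The same multiplied-out form as in [quot_withinP], harmless at [s = u]. Comparing the two turns
    limits along a set into library derivatives at interior points, and back. *)
Lemma is_deriveP f u l : is_derive u 1 f l <->
  forall e : R, 0 < e -> exists2 d : R, 0 < d & forall s, `|s - u| < d ->
    `|f s - f u - l * (s - u)| <= e * `|s - u|.
Proof.
have step : (h^-1 *: ((f \o shift u) (h *: 1) - f u) @[h --> 0^'] --> l) <->
  forall e : R, 0 < e -> exists2 d : R, 0 < d & forall s, `|s - u| < d ->
    `|f s - f u - l * (s - u)| <= e * `|s - u|.
  split=> [/cvgrPdist_le fl e e0|H].
    have [d /= d0 Hd] := fl e e0.
    exists d => // s sd; have [->|su] := eqVneq s u.
      by rewrite !subrr mulr0 subrr normr0 mulr0.
    have su0 : s - u != 0 by rewrite subr_eq0.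
    have := Hd (s - u); rewrite /= sub0r normrN => /(_ sd su0).
    rewrite /shift /= [(s - u) *: 1]mulr1 subrK => le.
    have -> : f s - f u - l * (s - u) =
        - ((l - (s - u)^-1 *: (f s - f u)) * (s - u)).
      by rewrite /GRing.scale /=; field.
    by rewrite normrN normrM; apply: ler_wpM2r.
  apply/cvgrPdist_le => e e0; have [d d0 Hd] := H e e0.
  exists d => //= h; rewrite /= sub0r normrN => hd h0.
  rewrite /shift /GRing.scale /= ?mulr1.
  have -> : l - h^-1 * (f (h + u) - f u) =
      - ((f (h + u) - f u - l * (h + u - u)) / h) by field.
  rewrite normrN normrM normfV ler_pdivrMr ?normr_gt0//.
  by have := Hd (h + u); rewrite addrK => /(_ hd).
split=> [[df dl]|H].
  by apply/step; rewrite -dl.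
have Hl := step.2 H.
constructor; first by apply/cvg_ex; exists l.
exact: cvg_lim Hl.
Qed.

Lemma is_derive_quot_within A f u l :
  is_derive u 1 f l -> quot_within A f u --> l.
Proof.
move=> /is_deriveP H; apply/quot_withinP => e /H[d d0 Hd].
by exists d => // s _; exact: Hd.
Qed.

Lemma quot_within_is_derive A f u l :
  nbhs u A -> quot_within A f u --> l -> is_derive u 1 f l.
Proof.
move=> [r /= r0 Ar] /quot_withinP H; apply/is_deriveP => e /H[d d0 Hd].
exists (Num.min d r); first by rewrite lt_min d0.
by move=> s; rewrite lt_min => /andP[sd sr]; apply: Hd => //; apply: Ar; rewrite /= distrC.
Qed.

Lemma nbhs_segment a b u : a < u < b -> nbhs u `[a, b].
Proof.
move=> uab; have := @near_in_itvoo R a b u; rewrite in_itv /= => /(_ uab).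
by apply: filterS => s /=; rewrite !in_itv /= => /andP[/ltW -> /ltW ->].
Qed.

Lemma quot_within_continuous A f (df : R -> R) :
  (forall u, A u -> quot_within A f u --> df u) -> {within A, continuous f}.
Proof.
move=> H; apply/subspace_continuousP => u Au.
apply/cvgrPdist_le => e e0.
have /quot_withinP /(_ 1 ltr01)[d d0 Hd] := H u Au.
have k0 : 0 < `|df u| + 1 by rewrite ltr_wpDl.
rewrite /= near_withinE.
exists (Num.min d (e / (`|df u| + 1))); first by rewrite /= lt_min d0 divr_gt0.
move=> s /=; rewrite lt_min distrC ltr_pdivlMr// => /andP[sd se] As.
rewrite distrC; apply: le_trans (ltW se).
have -> : f s - f u = f s - f u - df u * (s - u) + df u * (s - u) by ring.
apply: le_trans (ler_normD _ _) _.
rewrite [leRHS]mulrDr mulr1 addrC lerD //; first by rewrite normrM mulrC.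
by rewrite -[leRHS]mul1r Hd.
Qed.

(** [derive_within] is a [lim], and a limit found by hand identifies it only along a proper
    filter. *)
Lemma segment_within_proper a b u : a < b -> a <= u <= b ->
  ProperFilter (within `[a, b] u^').
Proof.
move=> ab /andP[au ub].
split; last exact: within_filter.
move=> [d /= d0 Hd].
(* Since [r] is at most half the length of the segment, [u + r] or [u - r] stays in it. *)
pose r := Num.min (d / 2) ((b - a) / 2).
have r0 : 0 < r by rewrite lt_min !divr_gt0// subr_gt0.
have rd : r < d.
  have : r <= d / 2 by rewrite ge_min lexx.
  lra.
have rab : r <= (b - a) / 2 by rewrite ge_min lexx orbT.
have [ub2|ub2] := leP (u + r) b.
- apply: (Hd (u + r)); rewrite /= ?in_itv /=.
  + by rewrite opprD addNKr normrN gtr0_norm.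
  + by apply/eqP; lra.
  + by apply/andP; split=> //; lra.
- apply: (Hd (u - r)); rewrite /= ?in_itv /=.
  + by rewrite opprB addrC subrK gtr0_norm.
  + by apply/eqP; lra.
  + by apply/andP; split=> //; lra.
Qed.

Lemma derive_withinE a b f u l : a < b -> a <= u <= b ->
  quot_within `[a, b] f u --> l -> derive_within `[a, b] f u = l.
Proof.
move=> ab uab fl; have := segment_within_proper ab uab => ?.
exact: (@cvg_lim _ (@norm_hausdorff _ _) _ _ _ _ _ fl).
Qed.

Lemma le_of_is_derive a b f (df : R -> R) : a <= b ->
  {within `[a, b], continuous f} ->
  (forall t, a < t < b -> is_derive t 1 f (df t)) ->
  (forall t, a < t < b -> 0 <= df t) -> f a <= f b.
Proof.
rewrite le_eqVlt => /predU1P[-> //|ab] fc fd d0.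
have fd' t : t \in `]a, b[%R -> is_derive t 1 f (df t).
  by rewrite in_itv /=; exact: fd.
have [c] := MVT ab fd' fc; rewrite in_itv /= => acb.
by move=> fE; rewrite -subr_ge0 fE mulr_ge0 ?subr_ge0 ?(ltW ab)// d0.
Qed.

End calculus.

(** * Functions and scalar equations on a segment *)

Section compact_interval.
Context {R : realType}.
Implicit Types (f g : R -> R) (a b u l : R) (A : set R).

Lemma within_segment_bounded a b f : {within `[a, b], continuous f} ->
  exists2 K : R, 0 <= K & forall u, a <= u <= b -> `|f u| <= K.
Proof.
have [ab|ba] := leP a b; last first.
  by move=> _; exists 0 => // u /andP[au ub]; have := le_lt_trans (le_trans au ub) ba; rewrite ltxx.
move=> fc; have [c _ fcM] := EVT_max ab fc; have [d _ fdm] := EVT_min ab fc.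
exists (`|f c| + `|f d|) => [|u uab]; first by rewrite addr_ge0.
rewrite ler_norml; apply/andP; split.
  have := fdm u; rewrite in_itv /= => /(_ uab); apply: le_trans.
  by move: (ler_norm (- f d)) (normr_ge0 (f c)); rewrite normrN; lra.
have := fcM u; rewrite in_itv /= => /(_ uab) /le_trans; apply.
by move: (ler_norm (f c)) (normr_ge0 (f d)); lra.
Qed.

Lemma within_segmentP a b f : {within `[a, b], continuous f} <->
  forall u, a <= u <= b -> forall e : R, 0 < e -> exists2 d : R, 0 < d &
    forall s, a <= s <= b -> `|s - u| < d -> `|f s - f u| <= e.
Proof.
split=> [/subspace_continuousP H u uab e e0|H].
  have /cvgrPdist_le/(_ e e0) := H u uab; rewrite near_withinE => -[d /= d0 Hd].
  by exists d => // s sab sd; rewrite distrC; apply: Hd => //=; rewrite distrC.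
apply/subspace_continuousP => u uab; apply/cvgrPdist_le => e e0.
have [d d0 Hd] := H u uab e e0.
rewrite near_withinE; exists d => //= s sd sab; rewrite distrC; apply: Hd => //.
by rewrite distrC.
Qed.

Lemma within_segment_subset a b c d f : a <= c -> d <= b ->
  {within `[a, b], continuous f} -> {within `[c, d], continuous f}.
Proof.
move=> ac db; apply: continuous_subspaceW => s /=.
by rewrite !in_itv /= => /andP[cs sd]; rewrite (le_trans ac cs) (le_trans sd db).
Qed.

(** Composing with this projection extends a function continuous on [[a, b]] to one continuous on
    the whole line, the form in which antiderivatives and perturbed equations are handled below. *)
Definition clamp a b (x : R) : R := Num.max a (Num.min b x).

Lemma clamp_itv a b (x : R) : a <= b -> a <= clamp a b x <= b.
Proof. by move=> ab; rewrite /clamp le_max lexx ge_max ab ge_min lexx. Qed.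

Lemma clamp_id a b (x : R) : a <= x <= b -> clamp a b x = x.
Proof. by rewrite /clamp => /andP[ax xb]; rewrite min_r// max_r. Qed.

Lemma clamp_lipschitz a b u v : `|clamp a b u - clamp a b v| <= `|u - v|.
Proof.
have h1 : `|Num.min b u - Num.min b v| <= `|u - v|.
  move: (ler_norm (u - v)) (ler_norm (v - u)); rewrite (distrC v u).
  by case: (leP b u); case: (leP b v) => *; rewrite ler_norml; apply/andP; split; lra.
apply: le_trans h1; rewrite /clamp.
move: (Num.min b u) (Num.min b v) => m n.
move: (ler_norm (m - n)) (ler_norm (n - m)); rewrite (distrC n m).
by case: (leP a m); case: (leP a n) => *; rewrite ler_norml; apply/andP; split; lra.
Qed.

Lemma clamp_continuous a b f : a <= b -> {within `[a, b], continuous f} ->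
  continuous (fun x : R => f (clamp a b x)).
Proof.
move=> ab /within_segmentP fc x; apply/cvgrPdist_le => e e0.
have [d d0 Hd] := fc _ (clamp_itv x ab) _ e0.
exists d => //= s sd; rewrite distrC; apply: Hd; first exact: clamp_itv.
by apply: le_lt_trans (clamp_lipschitz _ _ _ _) _; rewrite distrC.
Qed.

Lemma antiderivative f L U : continuous f ->
  exists F : R -> R, forall x : R, L < x < U -> is_derive x 1 F (f x).
Proof.
move=> fc; exists (fun x => \int[lebesgue_measure]_(t in `[L, x]) f t)%R.
move=> x /andP[Lx xU].
have fi : lebesgue_measure.-integrable `[L, U] (EFin \o f).
  apply: continuous_compact_integrable; first exact: segment_compact.
  exact: continuous_subspaceT.
have [dF fE] := @continuous_FTC1_closed R f L x U xU fi Lx (fc x).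
by rewrite -fE derive1E; apply/derivableP; exact: dF.
Qed.

Lemma is_derive_lipschitz a b K f (df : R -> R) :
  {within `[a, b], continuous f} ->
  (forall t, a < t < b -> is_derive t 1 f (df t)) ->
  (forall t, a < t < b -> `|df t| <= K) ->
  forall u v, a <= u <= b -> a <= v <= b -> `|f u - f v| <= K * `|u - v|.
Proof.
move=> fc fd dK.
suff H u v : a <= u -> u < v -> v <= b -> `|f v - f u| <= K * `|v - u|.
  move=> u v /andP[au ub] /andP[av vb].
  have [uv|vu|->] := ltgtP u v; last by rewrite !subrr normr0 mulr0.
    by rewrite distrC (distrC u); exact: H.
  exact: H.
move=> au uv vb.
have fd' t : t \in `]u, v[%R -> is_derive t 1 f (df t).
  rewrite in_itv /= => /andP[ut tv].
  by apply: fd; rewrite (le_lt_trans au ut) (lt_le_trans tv vb).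
have [c] := MVT uv fd' (within_segment_subset au vb fc).
rewrite in_itv /= => /andP[uc cv ->]; rewrite normrM ler_wpM2r//.
by apply: dK; rewrite (le_lt_trans au uc) (lt_le_trans cv vb).
Qed.

Lemma ode_solution_continuous a b A f (x : R -> R) :
  ode_solution `[a, b] A f x -> {within `[a, b], continuous x}.
Proof.
move=> H; apply: (@quot_within_continuous _ _ _ (fun t => f (x t))) => u uab.
exact: (H u uab).2.
Qed.

Lemma ode_solution_is_derive a b A f (x : R -> R) t : ode_solution `[a, b] A f x ->
  a < t < b -> is_derive t 1 x (f (x t)).
Proof.
move=> H tab; apply: (@quot_within_is_derive _ `[a, b]).
  exact: nbhs_segment.
apply: (H _ _).2; rewrite /= in_itv /=.
by case/andP: tab => /ltW -> /ltW ->.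
Qed.

Lemma within_continuousM a b f g : {within `[a, b], continuous f} ->
  {within `[a, b], continuous g} ->
  {within `[a, b], continuous (fun u => f u * g u)}.
Proof. by move=> fc gc u; apply: cvgM; [exact: fc|exact: gc]. Qed.

Lemma within_continuousB a b f g : {within `[a, b], continuous f} ->
  {within `[a, b], continuous g} ->
  {within `[a, b], continuous (fun u => f u - g u)}.
Proof. by move=> fc gc u; apply: cvgB; [exact: fc|exact: gc]. Qed.

(* Gronwall: [(x - w)^2 expR (c t)] is monotone for [c = 2 K] and [c = - 2 K]. *)
Lemma ode_solution_unique a b A f K (x w : R -> R) t0 :
  (forall u v, A u -> A v -> `|f u - f v| <= K * `|u - v|) ->
  ode_solution `[a, b] A f x -> ode_solution `[a, b] A f w ->
  a <= t0 <= b -> x t0 = w t0 -> forall t, a <= t <= b -> x t = w t.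
Proof.
move=> fL xs ws t0ab xw0 t tab.
pose e c s := (x s - w s) * (x s - w s) * expR (c * s).
pose de c s := 2 * (x s - w s) * (f (x s) - f (w s)) * expR (c * s)
               + (x s - w s) * (x s - w s) * (c * expR (c * s)).
have ec c : {within `[a, b], continuous (e c)}.
  apply: within_continuousM.
    by apply: within_continuousM; apply: within_continuousB;
      [exact: ode_solution_continuous xs|exact: ode_solution_continuous ws|
       exact: ode_solution_continuous xs|exact: ode_solution_continuous ws].
  apply: continuous_subspaceT => s; apply: continuous_comp; last exact: continuous_expR.
  by apply: cvgM; [exact: cvg_cst|exact: cvg_id].
have ed c s : a < s < b -> is_derive s 1 (e c) (de c s).
  move=> sab; have dx := ode_solution_is_derive xs sab.
  have dw := ode_solution_is_derive ws sab.
  have dE : is_derive s 1 (fun s => expR (c * s)) (c * expR (c * s)).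
    have d1 : is_derive s 1 (fun s : R => c * s) c.
      by have := is_deriveZ c (is_derive_id s (1 : R)); rewrite /GRing.scale /= mulr1.
    have := @is_derive1_comp R (@expR R) (fun s => c * s) s (expR (c * s)) c (is_derive_expR _) d1.
    by rewrite mulrC.
  have dd : is_derive s 1 (fun s => x s - w s) (f (x s) - f (w s)).
    exact: is_deriveB.
  apply: (is_derive_eq (is_deriveM (is_deriveM dd dd) dE)).
  rewrite /de /GRing.scale /= /GRing.mul_fun.
  by rewrite mulrfctE; ring.
have sq s : a < s < b ->
    `|(x s - w s) * (f (x s) - f (w s))| <= K * ((x s - w s) * (x s - w s)).
  move=> /andP[/ltW as_ /ltW sb].
  have sab : `[a, b] s by rewrite /= in_itv /= as_ sb.
  rewrite normrM -[X in K * X]ger0_norm -?expr2 ?sqr_ge0// expr2 normrM mulrCA.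
  by apply: ler_wpM2l => //; apply: fL; [exact: (xs _ sab).1|exact: (ws _ sab).1].
have e0 c : e c t0 = 0 by rewrite /e xw0 subrr !mul0r.
have fin c : e c t <= 0 -> x t = w t.
  rewrite /e pmulr_lle0 ?expR_gt0// -expr2 => h; apply/eqP.
  by rewrite -subr_eq0 -sqrf_eq0 eq_le h sqr_ge0.
(* [e c] is nonnegative and vanishes at [t0]. With [c = - 2 K] it is nonincreasing to the right of
   [t0], with [c = 2 K] nondecreasing to its left, so in both cases [e c t <= 0]. *)
have [t0t|tt0] := leP t0 t.
- apply: (fin (- (2 * K))); rewrite -(e0 (- (2 * K))) -lerN2.
  have tb : t <= b by case/andP: tab.
  have at0 : a <= t0 by case/andP: t0ab.
  apply: (@le_of_is_derive _ t0 t (fun s => - e (- (2 * K)) s) (fun s => - de (- (2 * K)) s)) => //.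
  + move=> s; apply: cvgN; exact: (within_segment_subset at0 tb (@ec _)).
  + move=> s /andP[s1 s2]; apply: is_deriveN; apply: ed.
    by rewrite (le_lt_trans at0 s1) (lt_le_trans s2 tb).
  + move=> s /andP[s1 s2].
    have /sq : a < s < b by rewrite (le_lt_trans at0 s1) (lt_le_trans s2 tb).
    rewrite ler_norml => /andP[h1 h2].
    rewrite /de oppr_ge0 [X in _ + X]mulrA -mulrDl pmulr_lle0 ?expR_gt0//.
    by move: h1 h2; rewrite -!mulrA; lra.
- apply: (fin (2 * K)); rewrite -(e0 (2 * K)).
  have at_ : a <= t by case/andP: tab.
  have t0b : t0 <= b by case/andP: t0ab.
  apply: (@le_of_is_derive _ t t0 _ (de (2 * K))) => //.
  + exact: ltW.
  + exact: (within_segment_subset at_ t0b (@ec _)).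
  + by move=> s /andP[s1 s2]; apply: ed; rewrite (le_lt_trans at_ s1) (lt_le_trans s2 t0b).
  + move=> s /andP[s1 s2].
    have /sq : a < s < b by rewrite (le_lt_trans at_ s1) (lt_le_trans s2 t0b).
    rewrite ler_norml => /andP[h1 h2].
    rewrite /de [X in _ + X]mulrA -mulrDl pmulr_lge0 ?expR_gt0//.
    by move: h1 h2; rewrite -!mulrA; lra.
Qed.

End compact_interval.

(** * Solving and perturbing a scalar autonomous equation by quadrature *)

Section quadrature.
Context {R : realType}.
Implicit Types (f F p phi : R -> R).

Lemma MVT_itv F dF L U : (forall u : R, L <= u <= U -> is_derive u 1 F (dF u)) ->
  forall u v, L <= u <= U -> L <= v <= U ->
  exists2 c, L <= c <= U & F u - F v = dF c * (u - v).
Proof.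
move=> Fd.
suff H u v : L <= u -> u < v -> v <= U ->
    exists2 c, L <= c <= U & F u - F v = dF c * (u - v).
  move=> u v /andP[Lu uU] /andP[Lv vU].
  have [uv|vu|->] := ltgtP u v.
  - exact: H.
  - have [c cI cE] := H v u Lv vu uU; exists c => //.
    by rewrite -opprB cE -mulrN opprB.
  - by exists v; rewrite ?Lv// !subrr mulr0.
move=> Lu uv vU.
have Fd' t : t \in `[u, v]%R -> is_derive t 1 F (dF t).
  by rewrite in_itv /= => /andP[ut tv]; apply: Fd; rewrite (le_trans Lu ut) (le_trans tv vU).
have Fc : {within `[u, v], continuous F}.
  by apply: derivable_within_continuous => t /Fd' [].
have Fd'' t : t \in `]u, v[%R -> is_derive t 1 F (dF t).
  by rewrite in_itv /= => /andP[/ltW ut /ltW tv]; apply: Fd'; rewrite in_itv /= ut.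
have [c] := MVT uv Fd'' Fc.
rewrite in_itv /= => /andP[uc cv] cE; exists c.
  by rewrite (le_trans Lu (ltW uc)) (le_trans (ltW cv) vU).
by rewrite -opprB cE -mulrN opprB.
Qed.

(** Separation of variables: the derivative of [F] never vanishes, so [F] is injective, [xget] can
    only return its inverse, and the derivative of the inverse is [p]. *)
Lemma ode_by_quadrature F p (L U z0 : R) :
  (forall u, L <= u <= U -> is_derive u 1 F (p u)^-1) ->
  (forall u, L <= u <= U -> 0 < p u) ->
  let z t := xget z0 [set u | L < u < U /\ F u = t] in
  forall u, L < u < U -> z (F u) = u /\ is_derive (F u) 1 z (p u).
Proof.
move=> Fd p0 z u uI.
have inj v w : L < v < U -> L < w < U -> F v = F w -> v = w.
  move=> /andP[/ltW Lv /ltW vU] /andP[/ltW Lw /ltW wU] vw.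
  have := MVT_itv Fd; move=> /(_ v w); rewrite Lv vU Lw wU => /(_ isT isT)[c cI].
  rewrite vw subrr => /esym/eqP; rewrite mulf_eq0 invr_eq0 subr_eq0.
  by rewrite gt_eqF ?p0//= => /eqP.
have zF w : L < w < U -> z (F w) = w.
  move=> wI; rewrite /z; case: xgetP => [v _ [vI vw]|/(_ w)]; first exact: inj.
  by case.
split; first exact: zF.
have nu : \forall w \near u, L < w < U.
  have := @near_in_itvoo R L U u; rewrite in_itv /= => /(_ uI).
  by apply: filterS => w; rewrite in_itv.
have uI' : L <= u <= U by case/andP: uI => /ltW -> /ltW ->.
have := @is_derive_inverse R F z (p u)^-1 u; rewrite invrK; apply.
- by apply: filterS nu.
- apply: filterS nu => w /andP[/ltW Lw /ltW wU].
  apply/differentiable_continuous; rewrite -derivable1_diffP.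
  by have [] := Fd w; rewrite ?Lw.
- exact: Fd.
- by rewrite invr_eq0 gt_eqF// p0.
Qed.

(* [F_h], a primitive of [1 / (f + h phi)], agrees with [F_0 - h Psi] up to
   [O(h^2)]; solving [F_h z = t] and comparing with [F_0 z = t] gives both
   the solution of the perturbed equation and its derivative in [h]. *)
Lemma ode_perturbation f phi (m N K al t0 t1 : R) :
  continuous f -> continuous phi -> 0 < m -> (forall u, m <= f u <= N) ->
  (forall u, `|phi u| <= K) -> t0 <= t1 ->
  exists (L U : R) (z : R -> R -> R) (Psi : R -> R) (h0 C : R),
    [/\ 0 < h0, L < al < U,
     (forall u, L < u < U -> is_derive u 1 Psi (phi u / f u ^+ 2)),
     Psi al = 0 &
     forall t, t0 <= t <= t1 ->
     [/\ (forall h : R, `|h| < h0 ->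
          [/\ al <= z h t < U, z h t0 = al, `|z h t - z 0 t| <= C * `|h| &
              is_derive t 1 (z h) (f (z h t) + h * phi (z h t))]) &
         is_derive (0 : R) 1 (z^~ t) (f (z 0 t) * Psi (z 0 t))]].
Proof.
move=> fc phic m0 fmN phiK t01.
have N0 : 0 < N by have /andP[h1 h2] := fmN 0; exact: lt_le_trans m0 (le_trans h1 h2).
have K0 : 0 <= K by exact: le_trans (normr_ge0 _) (phiK 0).
have f0 u : 0 < f u by have /andP[h1 _] := fmN u; exact: lt_le_trans m0 h1.
(* Perturbed right-hand sides stay below [2 * N], so travelling from [al] to [U] takes at least the
   time [t1 - t0 + 1]: no solution reaches [U] before [t1]. [L] only makes [al] an interior
   point. *)
pose L := al - 1; pose U := al + 2 * N * (t1 - t0 + 1).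
have NT : 0 < 2 * N * (t1 - t0 + 1).
  by rewrite !mulr_gt0// ltr_wpDl// subr_ge0.
have LU : L < U by rewrite /L /U; lra.
have aI : L < al < U by rewrite /L /U; apply/andP; split; lra.
(* For [|h| < h0] the perturbation is at most [m / 2], which keeps [f + h phi] between [m / 2] and
   [2 * N]. *)
pose h0 := m / (2 * (K + 1)).
have h0_gt0 : 0 < h0 by rewrite divr_gt0// mulr_gt0// ltr_wpDl.
have hphi h u : `|h| < h0 -> `|h * phi u| <= m / 2.
  move=> hh; rewrite normrM.
  apply: (@le_trans _ _ (h0 * (K + 1))).
    by apply: ler_pM => //; [exact: ltW|apply: le_trans (phiK u) _; lra].
  by rewrite /h0; rewrite le_eqVlt; apply/orP; left; apply/eqP; field; rewrite gt_eqF// ltr_wpDl.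
pose fh h u := f u + h * phi u.
have fh_bnd h u : `|h| < h0 -> m / 2 <= fh h u <= 2 * N.
  move=> /(hphi _ u); rewrite ler_norml /fh => /andP[h1 h2].
  by have /andP[h3 h4] := fmN u; apply/andP; split; lra.
have fh0 h u : `|h| < h0 -> 0 < fh h u.
  by move=> /(fh_bnd _ u)/andP[+ _]; apply: lt_le_trans; rewrite divr_gt0.
have [F0 F0d] : exists F : R -> R -> R, forall h : R, `|h| < h0 ->
    F h al = t0 /\ forall u, L <= u <= U -> is_derive u 1 (F h) (fh h u)^-1.
  suff /choice[F HF] : forall h : R, exists F : R -> R, `|h| < h0 ->
      F al = t0 /\ forall u, L <= u <= U -> is_derive u 1 F (fh h u)^-1 by exists F.
  move=> h; have [hh|_] := ltP `|h| h0; last by exists id.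
  have [F Fd] : exists F : R -> R, forall u, L - 1 < u < U + 1 ->
      is_derive u 1 F ((fh h u)^-1).
    apply: antiderivative => u; apply: cvgV; first by rewrite gt_eqF// fh0.
    by apply: cvgD; [exact: fc|apply: cvgM; [exact: cvg_cst|exact: phic]].
  exists (fun u => F u + (t0 - F al)) => _; split; first by ring.
  move=> u /andP[Lu uU].
  rewrite -[(fh h u)^-1]addr0; apply: is_deriveD.
  by apply: Fd; apply/andP; split; lra.
have [Psi0 Psi0d] : exists F : R -> R, forall u, L - 1 < u < U + 1 ->
      is_derive u 1 F (phi u / f u ^+ 2).
  apply: antiderivative => u; apply: cvgM; first exact: phic.
  apply: cvgV; first by rewrite gt_eqF// exprn_gt0.
  by apply: cvgM; exact: fc.
pose Psi u := Psi0 u - Psi0 al.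
have Psid u : L <= u <= U -> is_derive u 1 Psi (phi u / f u ^+ 2).
  move=> /andP[Lu uU]; rewrite -[phi u / _]subr0; apply: is_deriveB.
  by apply: Psi0d; apply/andP; split; lra.
have normh0 : `|0 : R| < h0 by rewrite normr0.
have Fmvt h : `|h| < h0 -> forall u v, L <= u <= U -> L <= v <= U ->
    exists2 c, L <= c <= U & F0 h u - F0 h v = (fh h c)^-1 * (u - v).
  by move=> hh; apply: MVT_itv; exact: (F0d h hh).2.
pose z h t := xget al [set u | L < u < U /\ F0 h u = t].
have zP h t : `|h| < h0 -> t0 <= t <= t1 ->
    al <= z h t < U /\ F0 h (z h t) = t.
  move=> hh /andP[t0t tt1].
  have [Fal Fd] := F0d h hh.
  have alU : al <= U by case/andP: aI => _ /ltW.
  have Lal : L <= al by case/andP: aI => /ltW.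
  have FU : t1 < F0 h U.
    have := Fmvt h hh U al; rewrite alU Lal (le_trans Lal alU) lexx => /(_ isT isT)[c cI].
    rewrite Fal => FE.
    suff : t1 - t0 + 1 <= (fh h c)^-1 * (U - al) by rewrite -FE; lra.
    have -> : U - al = (t1 - t0 + 1) * (2 * N) by rewrite /U; ring.
    rewrite mulrC ler_pdivlMr ?fh0//.
    have /andP[_ h2] := fh_bnd h c hh.
    by apply: ler_wpM2l => //; lra.
  have [||u] := @IVT R (F0 h) al U t alU.
  - apply: derivable_within_continuous => u; rewrite in_itv /= => /andP[au uU].
    by have [] := Fd u; rewrite ?(le_trans Lal au) ?uU.
  - by rewrite Fal le_max ge_min t0t /= (le_trans tt1 (ltW FU)) orbT.
  rewrite in_itv /= => /andP[au uU] Fu.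
  have uU' : u < U.
    rewrite lt_neqAle uU andbT; apply/eqP => uU'.
    by move: FU; rewrite -uU' Fu ltNge tt1.
  have Lu : L < u by case/andP: aI => La _; exact: lt_le_trans La au.
  have [zE _] := @ode_by_quadrature (F0 h) (fh h) L U al Fd (fun u _ => fh0 h u hh) u
    ltac:(by rewrite Lu).
  have zt : z h t = u by rewrite -Fu; exact: zE.
  by rewrite zt au uU' Fu.
have zI h t : `|h| < h0 -> t0 <= t <= t1 -> L < z h t < U.
  move=> hh /(zP h t hh)[/andP[az zU] _]; rewrite zU andbT.
  by case/andP: aI => La _; exact: lt_le_trans La az.
have zIw h t : `|h| < h0 -> t0 <= t <= t1 -> L <= z h t <= U.
  by move=> hh /(zI h t hh)/andP[/ltW -> /ltW ->].
(* The integrand [1/(f + h phi) - 1/f + h phi/f^2] equals [h^2 phi^2 / (f^2 (f + h phi))]; its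
   denominator is at least [m^3 / 2], and the length is at most [U - L]. *)
pose C2 := 2 * K ^+ 2 / m ^+ 3 * (U - L).
have alIw : L <= al <= U by case/andP: aI => /ltW -> /ltW ->.
have dist_LU u v : L <= u <= U -> L <= v <= U -> `|u - v| <= U - L.
  by move=> /andP[? ?] /andP[? ?]; rewrite ler_norml; apply/andP; split; lra.
have phif2 u : `|phi u / f u ^+ 2| <= K / m ^+ 2.
  rewrite normrM normfV (gtr0_norm (exprn_gt0 _ (f0 u))).
  apply: ler_pM; [by []|by rewrite invr_ge0 exprn_ge0// ltW|exact: phiK|].
  rewrite lef_pV2 ?posrE ?exprn_gt0//; apply: lerXn2r.
  - by rewrite nnegrE ltW.
  - by rewrite nnegrE ltW.
  - by have /andP[] := fmN u.
have fh00 u : fh 0 u = f u by rewrite /fh mul0r addr0.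
have FPsi h u : `|h| < h0 -> L <= u <= U ->
    `|F0 h u - F0 0 u + h * Psi u| <= C2 * h ^+ 2.
  move=> hh uI.
  pose E u := F0 h u - F0 0 u + h * Psi u.
  pose dE u := (fh h u)^-1 - (fh 0 u)^-1 + h * (phi u / f u ^+ 2).
  have Ed v : L <= v <= U -> is_derive v 1 E (dE v).
    move=> vI; apply: is_deriveD.
      by apply: is_deriveB; [exact: (F0d h hh).2|exact: (F0d 0 normh0).2].
    by have := is_deriveZ h (Psid v vI).
  have [c cI] := MVT_itv Ed uI alIw.
  rewrite {2}/E (F0d h hh).1 (F0d 0 normh0).1 /Psi !subrr mulr0 addr0 subr0 -/(Psi u) => EE.
  rewrite -/(E u) EE normrM.
  have -> : C2 * h ^+ 2 = (2 * K ^+ 2 / m ^+ 3 * h ^+ 2) * (U - L) by rewrite /C2; ring.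
  apply: ler_pM => //; last exact: dist_LU.
  have -> : dE c = h ^+ 2 * (phi c ^+ 2 / (f c ^+ 2 * fh h c)).
    rewrite /dE fh00; have := fh0 h c hh; rewrite /fh => /gt_eqF/negbT fhn0.
    by field; rewrite fhn0 gt_eqF.
  rewrite normrM (ger0_norm (sqr_ge0 h)) mulrC; apply: ler_wpM2r; first exact: sqr_ge0.
  have d0 : 0 < f c ^+ 2 * fh h c by rewrite mulr_gt0 ?fh0// exprn_gt0.
  rewrite normrM normfV (gtr0_norm d0) (ger0_norm (sqr_ge0 _)).
  have -> : 2 * K ^+ 2 / m ^+ 3 = K ^+ 2 / (m ^+ 2 * (m / 2)) by field; rewrite gt_eqF.
  apply: ler_pM; rewrite ?sqr_ge0 ?invr_ge0 ?(ltW d0)//.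
    by rewrite -[leLHS]ger0_norm ?sqr_ge0// normrX lerXn2r ?nnegrE.
  rewrite lef_pV2 ?posrE//; last by rewrite !mulr_gt0// exprn_gt0.
  apply: ler_pM; rewrite ?exprn_ge0 ?divr_ge0 ?(ltW m0)//.
    by apply: lerXn2r; rewrite ?nnegrE ?(ltW m0) ?(ltW (f0 _))//; have /andP[] := fmN c.
  by have /andP[] := fh_bnd h c hh.
have LU0 : 0 <= U - L by rewrite subr_ge0 ltW.
have C20 : 0 <= C2 by rewrite !mulr_ge0 ?invr_ge0 ?exprn_ge0 ?(ltW m0).
have Km0 : 0 <= K / m ^+ 2 by rewrite mulr_ge0 ?invr_ge0 ?exprn_ge0 ?(ltW m0).
have PsiL u v : L <= u <= U -> L <= v <= U -> `|Psi u - Psi v| <= K / m ^+ 2 * `|u - v|.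
  move=> uI vI; have [c cI ->] := MVT_itv Psid uI vI.
  by rewrite normrM ler_wpM2r.
have PsiB u : L <= u <= U -> `|Psi u| <= K / m ^+ 2 * (U - L).
  move=> uI; have := PsiL u al uI alIw; rewrite {2}/Psi subrr subr0 => /le_trans; apply.
  by rewrite ler_wpM2l// dist_LU.
have zF h t : `|h| < h0 -> t0 <= t <= t1 ->
    `|F0 0 (z h t) - F0 0 (z 0 t) - h * Psi (z h t)| <= C2 * h ^+ 2.
  move=> hh tI; have := FPsi h (z h t) hh (zIw h t hh tI).
  have [_ ->] := zP h t hh tI; have [_ ->] := zP 0 t normh0 tI.
  by rewrite -normrN opprD opprB => /le_trans; apply; rewrite lexx.
(* [F_0 (z h t) - F_0 (z 0 t)] is [h Psi] up to [C2 h^2], with one factor [|h|] bounded by [h0]; the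
   factor [N] converts values of [F_0] back into positions. *)
pose C1 := N * (K / m ^+ 2 * (U - L) + C2 * h0).
have z_lip h t : `|h| < h0 -> t0 <= t <= t1 -> `|z h t - z 0 t| <= C1 * `|h|.
  move=> hh tI.
  have [c cI] := Fmvt 0 normh0 _ _ (zIw h t hh tI) (zIw 0 t normh0 tI).
  rewrite fh00 => cE.
  have -> : z h t - z 0 t = f c * (F0 0 (z h t) - F0 0 (z 0 t)).
    by rewrite cE mulrA divff ?mul1r// gt_eqF.
  rewrite normrM (gtr0_norm (f0 c)) /C1 -mulrA.
  apply: ler_pM => //; [exact: ltW|by have /andP[] := fmN c|].
  have -> : F0 0 (z h t) - F0 0 (z 0 t) =
     h * Psi (z h t) + (F0 0 (z h t) - F0 0 (z 0 t) - h * Psi (z h t)) by ring.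
  apply: le_trans (ler_normD _ _) _; rewrite mulrDl; apply: lerD.
    by rewrite normrM mulrC ler_wpM2r// PsiB// zIw.
  apply: le_trans (zF h t hh tI) _.
  rewrite -mulrA ler_wpM2l// -[h ^+ 2]ger0_norm ?sqr_ge0// normrX expr2.
  by rewrite ler_wpM2r// ltW.
have C10 : 0 <= C1.
  by apply: mulr_ge0; [exact: ltW|apply: addr_ge0; apply: mulr_ge0 => //; exact: ltW].
exists L, U, z, Psi, h0, C1; split => //.
- by move=> u /andP[/ltW Lu /ltW uU]; apply: Psid; rewrite Lu.
- by rewrite /Psi subrr.
move=> t tI; split=> [h hh|].
  have [zU zE] := zP h t hh tI.
  have [Fal Fd] := F0d h hh.
  have q := @ode_by_quadrature (F0 h) (fh h) L U al Fd (fun u _ => fh0 h u hh).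
  split => //; last by have [_] := q _ (zI h t hh tI); rewrite zE.
    by have [+ _] := q _ aI; rewrite Fal.
  exact: z_lip.
apply/is_deriveP => e e0.
have z0I := zIw 0 t normh0 tI.
have := (F0d 0 normh0).2 _ z0I.
rewrite fh00 => /is_deriveP F0der.
pose e1 := e / (2 * (N * (C1 + 1))).
have D1 : 0 < 2 * (N * (C1 + 1)) by rewrite !mulr_gt0// ltr_wpDl.
have e10 : 0 < e1 by rewrite divr_gt0.
have [d d0 Hd] := F0der e1 e10.
pose C3 := N * (K / m ^+ 2 * C1 + C2).
have C30 : 0 <= C3 by rewrite mulr_ge0 ?(ltW N0)// addr_ge0// mulr_ge0.
pose r := Num.min h0 (Num.min (d / (C1 + 1)) (e / (2 * (C3 + 1)))).
have C110 : 0 < C1 + 1 by rewrite ltr_wpDl.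
have C310 : 0 < C3 + 1 by rewrite ltr_wpDl.
exists r; first by rewrite !lt_min h0_gt0 !divr_gt0// mulr_gt0.
move=> h; rewrite subr0 !lt_min => /and3P[hh hd he].
have zl := z_lip h t hh tI.
have zd : `|z h t - z 0 t| < d.
  apply: le_lt_trans zl _; apply: (@le_lt_trans _ _ ((C1 + 1) * `|h|)).
    by rewrite ler_wpM2r// lerDl.
  by rewrite mulrC -ltr_pdivlMr.
have := Hd _ zd.
set u := z h t in zl zd *; set v := z 0 t in z0I zl zd *.
have uI : L <= u <= U by exact: zIw.
have zFh := zF h t hh tI.
have PL := PsiL u v uI z0I.
move=> Hfv.
(* Three errors: the remainder of the quadrature and the variation of [Psi] between [v] and [u] are
   both [O(h^2)] and make up [C3]; the Taylor remainder of [F_0] at [v] is at most [e1 |u - v|]. The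
   choices of [r] and [e1] give each group half of [e]. *)
have -> : u - v - f v * Psi v * h =
  f v * ((F0 0 u - F0 0 v - h * Psi u) + h * (Psi u - Psi v)
         - (F0 0 u - F0 0 v - (f v)^-1 * (u - v))).
  by field; rewrite gt_eqF.
rewrite normrM (gtr0_norm (f0 v)).
apply: (@le_trans _ _ (N * (C2 * h ^+ 2 + `|h| * (K / m ^+ 2 * (C1 * `|h|)) + e1 * (C1 * `|h|)))).
  apply: ler_pM => //; [exact: ltW|by have /andP[] := fmN v|].
  apply: le_trans (ler_normB _ _) _; apply: lerD; last first.
    by apply: le_trans Hfv _; rewrite ler_wpM2l// ltW.
  apply: le_trans (ler_normD _ _) _; apply: lerD => //.
  rewrite normrM ler_wpM2l//; apply: le_trans PL _.
  by rewrite ler_wpM2l.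
have h2 : h ^+ 2 = `|h| * `|h| by rewrite -expr2 -normrX ger0_norm// sqr_ge0.
rewrite h2.
have -> : N * (C2 * (`|h| * `|h|) + `|h| * (K / m ^+ 2 * (C1 * `|h|)) + e1 * (C1 * `|h|))
   = (C3 * `|h| + e1 * (N * C1)) * `|h| by rewrite /C3; ring.
apply: ler_wpM2r => //.
have i1 : C3 * `|h| <= e / 2.
  apply: (@le_trans _ _ ((C3 + 1) * (e / (2 * (C3 + 1))))).
    by apply: ler_pM => //; [lra|exact: ltW].
  by rewrite le_eqVlt; apply/orP; left; apply/eqP; field; rewrite gt_eqF.
have i2 : e1 * (N * C1) <= e / 2.
  apply: (@le_trans _ _ (e1 * (N * (C1 + 1)))).
    by rewrite !ler_wpM2l ?(ltW e10) ?(ltW N0)// lerDl.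
  by rewrite le_eqVlt; apply/orP; left; apply/eqP; rewrite /e1; field; rewrite !gt_eqF.
lra.
Qed.

End quadrature.

(** * Quadratic forms and the operator norm *)

Section quadratic_forms.
Context {R : realType}.

Definition dotv n (u v : 'cV[R]_n) : R := \sum_i u i ord0 * v i ord0.

Lemma dotvE n (u v : 'cV[R]_n) : dotv u v = (u^T *m v) ord0 ord0.
Proof. by rewrite !mxE; apply: eq_bigr => i _; rewrite !mxE. Qed.

Lemma dotvC n (u v : 'cV[R]_n) : dotv u v = dotv v u.
Proof. by apply: eq_bigr => i _; rewrite mulrC. Qed.

Lemma dotvDr n (u v w : 'cV[R]_n) : dotv u (v + w) = dotv u v + dotv u w.
Proof. by rewrite !dotvE mulmxDr mxE. Qed.

Lemma dotvZr n (u v : 'cV[R]_n) a : dotv u (a *: v) = a * dotv u v.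
Proof. by rewrite !dotvE -scalemxAr mxE. Qed.

Lemma dotvDl n (u v w : 'cV[R]_n) : dotv (v + w) u = dotv v u + dotv w u.
Proof. by rewrite dotvC dotvDr !(dotvC u). Qed.

Lemma dotvZl n (u v : 'cV[R]_n) a : dotv (a *: u) v = a * dotv u v.
Proof. by rewrite dotvC dotvZr dotvC. Qed.

Lemma dotv_mulmx n (u v : 'cV[R]_n) (S : 'M[R]_n) :
  dotv u (S *m v) = dotv (S^T *m u) v.
Proof. by rewrite !dotvE trmx_mul trmxK mulmxA. Qed.

Lemma dotv_ge0 n (u : 'cV[R]_n) : 0 <= dotv u u.
Proof. by apply: sumr_ge0 => i _; rewrite -expr2 sqr_ge0. Qed.

Lemma dotv_eq0 n (u : 'cV[R]_n) : (dotv u u == 0) = (u == 0).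
Proof.
apply/idP/eqP => [|->]; last by rewrite /dotv big1// => i _; rewrite mxE mul0r.
rewrite psumr_eq0 => [/allP u0|i _]; last by rewrite -expr2 sqr_ge0.
apply/matrixP => i j; rewrite (ord1 j) !mxE; apply/eqP.
by have := u0 i (mem_index_enum i); rewrite /= mulf_eq0 orbb.
Qed.

Lemma dotv_gt0 n (u : 'cV[R]_n) : (0 < dotv u u) = (u != 0).
Proof. by rewrite lt0r dotv_ge0 andbT dotv_eq0. Qed.

Lemma enormE n (v : 'cV[R]_n) : enorm v = Num.sqrt (dotv v v).
Proof. by congr Num.sqrt; apply: eq_bigr => i _; rewrite expr2. Qed.

(** Discriminant argument. Only semidefiniteness is assumed, because the lemma is applied to
    [S - mu] with [mu] the infimum of the Rayleigh quotient; hence the separate case of a vanishing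
    leading coefficient. *)
Lemma form_cauchy_schwarz n (B : 'M[R]_n) : B^T = B ->
  (forall v, 0 <= dotv v (B *m v)) ->
  forall u w, dotv u (B *m w) ^+ 2 <= dotv u (B *m u) * dotv w (B *m w).
Proof.
move=> Bs B0 u w.
have E t : dotv (u + t *: w) (B *m (u + t *: w)) =
    dotv u (B *m u) + 2 * t * dotv u (B *m w) + t ^+ 2 * dotv w (B *m w).
  rewrite mulmxDr -scalemxAr !(dotvDl, dotvDr, dotvZl, dotvZr).
  by rewrite (dotv_mulmx w u) Bs (dotvC (B *m w)); ring.
have H t : 0 <= dotv u (B *m u) + 2 * t * dotv u (B *m w) + t ^+ 2 * dotv w (B *m w).
  by rewrite -E.
move: (H) (B0 u) (B0 w).
move: (dotv u (B *m u)) (dotv u (B *m w)) (dotv w (B *m w)) => a b c {}H a0 c0.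
have [c1|] := ltP 0 c.
  have := H (- b / c).
  have -> : a + 2 * (- b / c) * b + (- b / c) ^+ 2 * c = (a * c - b ^+ 2) / c.
    by field; rewrite gt_eqF.
  by rewrite pmulr_lge0 ?invr_gt0// subr_ge0.
move=> c00; have {c0 c00} c0 : c = 0 by apply/le_anti; rewrite c00.
have [->|b0] := eqVneq b 0; first by rewrite expr0n c0 mulr0.
(* With [c = 0] the form is affine in [t], and this [t] gives it the value [-1]. *)
have := H (- (a + 1) / (2 * b)).
rewrite c0 mulr0 addr0.
have -> : a + 2 * (- (a + 1) / (2 * b)) * b = -1 by field.
by rewrite ler0N1.
Qed.

Lemma cauchy_schwarz n (u w : 'cV[R]_n) :
  dotv u w ^+ 2 <= dotv u u * dotv w w.
Proof.
have := @form_cauchy_schwarz n 1%:M (trmx1 _ _) _ u w.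
by rewrite !mul1mx; apply => v; rewrite mul1mx dotv_ge0.
Qed.

Lemma mulmx_bounded n (A : 'M[R]_n) :
  exists2 K : R, 0 <= K & forall v, dotv (A *m v) (A *m v) <= K * dotv v v.
Proof.
(* The squared Frobenius norm. *)
exists (\sum_i dotv (row i A)^T (row i A)^T).
  by apply: sumr_ge0 => i _; exact: dotv_ge0.
move=> v; rewrite mulr_suml; apply: ler_sum => i _.
rewrite -expr2; have -> : (A *m v) i ord0 = dotv (row i A)^T v.
  by rewrite !mxE; apply: eq_bigr => j _; rewrite !mxE.
exact: cauchy_schwarz.
Qed.

(* The infimum [mu] of the Rayleigh quotient is an eigenvalue: otherwise
   [S - mu] would be invertible and nonnegative, hence bounded below. *)
Lemma dotv_form_ge n (S : 'M[R]_n) c : S^T = S ->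
  (forall a, eigenvalue S a -> c <= a) ->
  forall v, c * dotv v v <= dotv v (S *m v).
Proof.
move=> Ss Sc v; have [->|v0] := eqVneq v 0.
  by rewrite mulmx0 /dotv !big1 ?mulr0// => i _; rewrite mxE mul0r.
(* [Q] is the set of lower bounds of the Rayleigh quotient; its supremum [mu] is the infimum of that
   quotient. *)
pose Q := [set m | forall w, m * dotv w w <= dotv w (S *m w)].
have [K K0 SK] := mulmx_bounded S.
(* Expand [0 <= |w + S w|^2] and use [|S w|^2 <= K |w|^2]. *)
have Q0 : Q (- (1 + K) / 2).
  move=> w; have := dotv_ge0 (w + S *m w).
  rewrite !(dotvDl, dotvDr) (dotvC (S *m w) w); move: (SK w) (dotv_ge0 w).
  nra.
have Qub : ubound Q (dotv v (S *m v) / dotv v v).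
  by move=> m Qm; rewrite ler_pdivlMr ?dotv_gt0.
have Qsup : has_sup Q by split; [exists (- (1 + K) / 2)|exists (dotv v (S *m v) / dotv v v)].
pose mu := sup Q.
have Qmu : Q mu.
  move=> w; have [->|w0] := eqVneq w 0.
    by rewrite mulmx0 /dotv !big1 ?mulr0// => i _; rewrite mxE mul0r.
  rewrite -ler_pdivlMr ?dotv_gt0//; apply: ge_sup; first exact: Qsup.1.
  by move=> m Qm; rewrite ler_pdivlMr ?dotv_gt0.
have [cmu|muc] := leP c mu.
  by apply: le_trans (Qmu v); rewrite ler_wpM2r ?dotv_ge0.
pose B := S - mu%:M.
have Bv w : dotv w (B *m w) = dotv w (S *m w) - mu * dotv w w.
  by rewrite /B mulmxBl mul_scalar_mx -scaleNr dotvDr dotvZr mulNr.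
have B0 w : 0 <= dotv w (B *m w) by rewrite Bv subr_ge0.
have Bs : B^T = B by rewrite /B linearB /= Ss tr_scalar_mx.
have Bu : B \in unitmx.
  rewrite -row_free_unit -kermx_eq0; apply: contraTT muc => ker0.
  by rewrite -leNgt; apply: Sc.
have [K1 K10 BK] := mulmx_bounded B.
have [K2 K20 iBK] := mulmx_bounded (invmx B).
(* Invertibility gives [|w|^2 <= K2 |B w|^2], and Cauchy-Schwarz for the form [B] at [w] and [B w]
   gives [|B w|^2 <= (K1 + 1) (w . B w)]. So [mu] could be raised by [(K2 (K1 + 1))^-1] and stay in
   [Q], against its maximality. *)
have low w : dotv w w <= K2 * (K1 + 1) * dotv w (B *m w).
  have h1 : dotv w w <= K2 * dotv (B *m w) (B *m w).
    by have := iBK (B *m w); rewrite mulKmx.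
  apply: le_trans h1 _; rewrite -mulrA ler_wpM2l//.
  set z := B *m w.
  have h2 : dotv z z ^+ 2 <= dotv w z * dotv z (B *m z).
    have -> : dotv z z = dotv w (B *m z) by rewrite dotv_mulmx Bs.
    exact: form_cauchy_schwarz.
  have h3 : dotv z (B *m z) <= (K1 + 1) * dotv z z.
    have h4 := dotv_ge0 (z - B *m z); have h5 := BK z.
    rewrite -scaleN1r !(dotvDl, dotvDr, dotvZl, dotvZr) (dotvC (B *m z) z) in h4.
    have h6 := cauchy_schwarz z (B *m z).
    have h7 := B0 z; have h8 := dotv_ge0 z.
    move: h5 h6 h7 h8 K10 {h2 h4}.
    move: (dotv z z) (dotv z (B *m z)) (dotv (B *m z) (B *m z)) => x y t h5 h6 h7 h8 K10.
    have : y ^+ 2 <= ((K1 + 1) * x) ^+ 2.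
      apply: le_trans h6 _; apply: (@le_trans _ _ (x * (K1 * x))); first exact: ler_wpM2l.
      rewrite exprMn; have := sqr_ge0 x; nra.
    by rewrite ler_sqr// nnegrE// mulr_ge0// addr_ge0.
  have [->|z0] := eqVneq (dotv z z) 0.
    by rewrite mulr_ge0 ?addr_ge0// B0.
  have zp : 0 < dotv z z by rewrite lt0r z0 dotv_ge0.
  rewrite -(ler_pM2r zp) -expr2; apply: le_trans h2 _.
  by rewrite (mulrC (K1 + 1)) -mulrA ler_wpM2l// B0.
have Kp : 0 < K2 * (K1 + 1).
  rewrite lt0r mulr_ge0 ?addr_ge0// andbT; apply/eqP => K00.
  by have := low v; rewrite K00 mul0r leNgt dotv_gt0 v0.
have : Q (mu + (K2 * (K1 + 1))^-1).
  by move=> w; rewrite mulrDl -lerBrDl -Bv mulrC ler_pdivrMr// mulrC.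
move=> /(ub_le_sup Qsup.2); rewrite -/mu gerDl leNgt invr_gt0 Kp.
by [].
Qed.

Lemma coercive_unitmx n (G : 'M[R]_n) k : 0 < k ->
  (forall v, k * dotv v v <= dotv v (G *m v)) -> G \in unitmx.
Proof.
move=> k0 Gk; rewrite -row_free_unit -kermx_eq0; apply/negPn/negP.
move=> /rowV0Pn[u /sub_kermxP uG u0].
have := Gk u^T; rewrite [leRHS]dotvE trmxK mulmxA uG mul0mx mxE.
by rewrite pmulr_rle0// leNgt dotv_gt0 trmx_eq0 u0.
Qed.

(** For [w = G^-1 v], coercivity and Cauchy-Schwarz give [k |w|^2 <= w . v <= |w| |v|]. As [opnorm]
    is a [sup], the set must also be shown nonempty; its element [0] yields the lower bound. *)
Lemma opnorm_invmx_le n (G : 'M[R]_n) k : 0 < k ->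
  (forall v, k * dotv v v <= dotv v (G *m v)) ->
  0 <= opnorm (invmx G) <= k^-1.
Proof.
move=> k0 Gk; have Gu := coercive_unitmx k0 Gk.
set A := [set enorm (invmx G *m v) | v in [set v | enorm v <= 1]].
have A0 : A 0.
  exists 0; rewrite ?mulmx0 /= enormE; last by rewrite (eqP (_ : dotv 0 0 == 0)) ?dotv_eq0 ?sqrtr0.
  by rewrite (eqP (_ : dotv 0 0 == 0)) ?dotv_eq0 ?sqrtr0.
have Aub : ubound A k^-1.
  move=> _ [v /= v1 <-].
  set w := invmx G *m v; have vE : v = G *m w by rewrite /w mulKVmx.
  have h1 := Gk w; have h2 := cauchy_schwarz w (G *m w).
  rewrite -vE in h1 h2.
  have h3 : dotv v v <= 1.
    by move: v1; rewrite enormE -{1}(sqrtr1 R) ler_psqrt ?nnegrE ?dotv_ge0.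
  have h4 := dotv_ge0 w; have h5 := dotv_ge0 v.
  have h6 : dotv w w <= k^-1 ^+ 2.
    rewrite exprVn -div1r ler_pdivlMr ?exprn_gt0//.
    have [->|w0] := eqVneq (dotv w w) 0; first by rewrite mul0r.
    have wp : 0 < dotv w w by rewrite lt0r w0.
    have : (k * dotv w w) ^+ 2 <= dotv w w * dotv v v.
      by apply: le_trans h2; rewrite ler_sqr ?nnegrE ?(le_trans _ h1) ?mulr_ge0 ?(ltW k0).
    rewrite exprMn (expr2 (dotv w w)) mulrA (mulrC (_ * _) (dotv w w)) ler_pM2l//.
    by rewrite mulrC => /le_trans; apply.
  rewrite enormE -(ger0_norm (_ : 0 <= k^-1)) ?invr_ge0 ?(ltW k0)// -sqrtr_sqr.
  by rewrite ler_psqrt ?nnegrE ?sqr_ge0.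
have As : has_sup A by split; [exists 0|exists k^-1].
rewrite /opnorm -/A; apply/andP; split; first exact: (ub_le_sup As.2).
by apply: ge_sup => //; exact: As.1.
Qed.

End quadratic_forms.

(** * Integrals on a segment *)

Section segment_integrals.
Context {R : realType}.
Implicit Types (f F H q : R -> R) (a b : R).
Local Notation mu := (@lebesgue_measure R).

Lemma within_integrable a b f :
  {within `[a, b], continuous f} -> mu.-integrable `[a, b] (EFin \o f).
Proof. by move=> fc; apply: continuous_compact_integrable => //; exact: segment_compact. Qed.

Lemma within_continuousD a b f q : {within `[a, b], continuous f} ->
  {within `[a, b], continuous q} ->
  {within `[a, b], continuous (fun u => f u + q u)}.
Proof. by move=> fc gc u; apply: cvgD; [exact: fc|exact: gc]. Qed.

Lemma within_continuousZ a b f c : {within `[a, b], continuous f} ->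
  {within `[a, b], continuous (fun u => c * f u)}.
Proof. by move=> fc u; apply: cvgM; [exact: cvg_cst|exact: fc]. Qed.

Arguments within_continuousZ {a b f} c _.

Lemma within_continuous2 a b f : {within `[a, b], continuous f} ->
  {within `[a, b], continuous (fun u => f u ^+ 2)}.
Proof. by move=> fc; exact: within_continuousM. Qed.

Lemma within_continuousV a b f : (forall u, a <= u <= b -> f u != 0) ->
  {within `[a, b], continuous f} ->
  {within `[a, b], continuous (fun u => (f u)^-1)}.
Proof.
move=> f0 /subspace_continuousP fc; apply/subspace_continuousP => u uab.
by apply: cvgV; [exact: f0|exact: fc].
Qed.

Lemma is_derive_within_continuous a b F f :
  (forall u, a <= u <= b -> is_derive u 1 F (f u)) ->
  {within `[a, b], continuous F}.
Proof.
move=> Fd; apply: derivable_within_continuous => u; rewrite in_itv /= => uab.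
by have [] := Fd u uab.
Qed.

Lemma Rintegral_FTC2 a b F f : a < b -> {within `[a, b], continuous f} ->
  {within `[a, b], continuous F} ->
  (forall u, a < u < b -> is_derive u 1 F (f u)) ->
  \int[mu]_(u in `[a, b]) f u = F b - F a.
Proof.
move=> ab fc Fc Fd; rewrite /Rintegral (@continuous_FTC2 _ f F)//.
- have /(continuous_within_itvP _ ab)[_ Fa Fb] := Fc.
  by split => // u; rewrite in_itv /= => /Fd[].
- by move=> u; rewrite in_itv /= => uab; rewrite derive1E; have [_ ->] := Fd u uab.
Qed.

Lemma Rintegral_young a b f q (l : R) : 0 < l ->
  {within `[a, b], continuous f} -> {within `[a, b], continuous q} ->
  \int[mu]_(u in `[a, b]) (f u * q u) <=
  l / 2 * \int[mu]_(u in `[a, b]) (f u ^+ 2)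
  + (2 * l)^-1 * \int[mu]_(u in `[a, b]) (q u ^+ 2).
Proof.
move=> l0 fc qc.
have f2 := within_integrable (within_continuous2 fc).
have q2 := within_integrable (within_continuous2 qc).
have f2' := within_integrable (within_continuousZ (l / 2) (within_continuous2 fc)).
have q2' := within_integrable (within_continuousZ (2 * l)^-1 (within_continuous2 qc)).
rewrite -!RintegralZl// -RintegralD//.
apply: le_Rintegral => //.
- exact: within_integrable (within_continuousM fc qc).
- exact: within_integrable (within_continuousD
    (within_continuousZ _ (within_continuous2 fc)) (within_continuousZ _ (within_continuous2 qc))).
move=> u _; rewrite -subr_ge0.
have -> : l / 2 * f u ^+ 2 + (2 * l)^-1 * q u ^+ 2 - f u * q u
  = (2 * l)^-1 * (l * f u - q u) ^+ 2 by field; rewrite gt_eqF.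
by rewrite mulr_ge0 ?sqr_ge0// invr_ge0 mulr_ge0// ltW.
Qed.

(* [int q^2 = H(b) q(b) - int H q'] and [H(b)^2 = 2 int H q]; weighted AM-GM
   absorbs every factor but [int H^2]. *)
Lemma interpolation_ineq (c C : R) : 0 < c -> 0 < C ->
  exists2 k : R, 0 < k & forall a b q dq H (s A : R), a < b -> 0 < s -> 0 <= A ->
    {within `[a, b], continuous q} -> {within `[a, b], continuous dq} ->
    {within `[a, b], continuous H} ->
    (forall u, a < u < b -> is_derive u 1 q (dq u)) ->
    (forall u, a < u < b -> is_derive u 1 H (q u)) -> H a = 0 ->
    c * A <= \int[mu]_(u in `[a, b]) (q u ^+ 2) <= C * A ->
    \int[mu]_(u in `[a, b]) (dq u ^+ 2) <= C * s ^+ 2 * A ->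
    q b ^+ 2 <= C * s * A ->
    k / s ^+ 2 * A <= \int[mu]_(u in `[a, b]) (H u ^+ 2).
Proof.
(* The denominator of [k] is [(l + m n) / (2 s^2)] for the weights [l], [m], [n] chosen below. *)
move=> c0 C0; pose k := (c / 4) / (C / c + 4 * C ^+ 3 / c ^+ 3).
have D0 : 0 < C / c + 4 * C ^+ 3 / c ^+ 3.
  by rewrite addr_gt0 ?divr_gt0 ?mulr_gt0 ?exprn_gt0.
exists k; first by rewrite /k !divr_gt0.
move=> a b q dq H s A ab s0 A0 qc dqc Hc qd Hd Ha /andP[Q1 Q2] Q3 Q4.
set N := \int[mu]_(u in `[a, b]) (H u ^+ 2).
have E1 : \int[mu]_(u in `[a, b]) (q u ^+ 2) + \int[mu]_(u in `[a, b]) (H u * dq u) = H b * q b.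
  rewrite -RintegralD//; last 2 first.
  - exact: within_integrable (within_continuous2 qc).
  - exact: within_integrable (within_continuousM Hc dqc).
  rewrite -[RHS]subr0 -[X in _ - X](mul0r (q a)) -[in X in _ - X]Ha.
  apply: (@Rintegral_FTC2 _ _ (fun u => H u * q u)) => //.
  - exact: within_continuousD (within_continuous2 qc) (within_continuousM Hc dqc).
  - exact: within_continuousM.
  - move=> u uab; apply: (is_derive_eq (is_deriveM (Hd u uab) (qd u uab))).
    by rewrite /GRing.scale /=; ring.
have E2 : 2 * \int[mu]_(u in `[a, b]) (H u * q u) = H b ^+ 2.
  rewrite -RintegralZl//; last exact: within_integrable (within_continuousM Hc qc).
  rewrite expr2 -[RHS]subr0 -[X in _ - X](mul0r (H a)) -[in X in _ - (X * _)]Ha.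
  apply: (@Rintegral_FTC2 _ _ (fun u => H u * H u)) => //.
  - exact: within_continuousZ (within_continuousM Hc qc).
  - exact: within_continuousM.
  - move=> u uab; apply: (is_derive_eq (is_deriveM (Hd u uab) (Hd u uab))).
    by rewrite /GRing.scale /=; ring.
have N0 : 0 <= N by apply: Rintegral_ge0 => u _; exact: sqr_ge0.
(* The weights [l], [m], [n] make each of the three AM-GM remainders equal to [c / 4 * A], which
   leaves [c / 4 * A] out of the lower bound [c * A] for the integral of [q^2]. *)
pose l := 2 * C * s ^+ 2 / c.
have l0 : 0 < l by rewrite /l !mulr_gt0 ?invr_gt0 ?exprn_gt0.
have Y1 : - (\int[mu]_(u in `[a, b]) (H u * dq u)) <= l / 2 * N + c / 4 * A.
  have := Rintegral_young l0 Hc (within_continuousZ (-1) dqc).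
  have -> : \int[mu]_(u in `[a, b]) (H u * (-1 * dq u)) = - \int[mu]_(u in `[a, b]) (H u * dq u).
    rewrite -[RHS]mulN1r -RintegralZl//; last exact: within_integrable (within_continuousM Hc dqc).
    by apply: eq_Rintegral => u _; ring.
  have -> : \int[mu]_(u in `[a, b]) ((-1 * dq u) ^+ 2) = \int[mu]_(u in `[a, b]) (dq u ^+ 2).
    by apply: eq_Rintegral => u _; ring.
  move=> /le_trans; apply; apply: lerD => //.
  apply: (@le_trans _ _ ((2 * l)^-1 * (C * s ^+ 2 * A))).
    by rewrite ler_wpM2l// invr_ge0 mulr_ge0// ltW.
  by rewrite le_eqVlt; apply/orP; left; apply/eqP; rewrite /l; field; rewrite !gt_eqF.
pose m := 2 * C * s / c.
have m0 : 0 < m by rewrite /m !mulr_gt0 ?invr_gt0.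
pose n := 2 * m * C / c.
have n0 : 0 < n by rewrite /n !mulr_gt0 ?invr_gt0.
have Y2 : H b * q b <= m / 2 * H b ^+ 2 + c / 4 * A.
  apply: (@le_trans _ _ (m / 2 * H b ^+ 2 + (2 * m)^-1 * q b ^+ 2)).
    rewrite -subr_ge0.
    have -> : m / 2 * H b ^+ 2 + (2 * m)^-1 * q b ^+ 2 - H b * q b
      = (2 * m)^-1 * (m * H b - q b) ^+ 2 by field; rewrite gt_eqF.
    by rewrite mulr_ge0 ?sqr_ge0// invr_ge0 mulr_ge0// ltW.
  rewrite lerD2l; apply: (@le_trans _ _ ((2 * m)^-1 * (C * s * A))).
    by rewrite ler_wpM2l// invr_ge0 mulr_ge0// ltW.
  by rewrite le_eqVlt; apply/orP; left; apply/eqP; rewrite /m; field; rewrite !gt_eqF.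
have Y3 : m / 2 * H b ^+ 2 <= m * n / 2 * N + c / 4 * A.
  rewrite -E2 mulrA divfK ?pnatr_eq0//.
  have := Rintegral_young n0 Hc qc; rewrite -/N => /(ler_wpM2l (ltW m0)) /le_trans; apply.
  rewrite mulrDr; apply: lerD; first by rewrite !mulrA.
  apply: (@le_trans _ _ (m * ((2 * n)^-1 * (C * A)))).
    by rewrite ler_wpM2l ?(ltW m0)// ler_wpM2l// invr_ge0 mulr_ge0// ltW.
  by rewrite le_eqVlt; apply/orP; left; apply/eqP; rewrite /n /m; field; rewrite !gt_eqF.
have main : c / 4 * A <= (l / 2 + m * n / 2) * N by rewrite mulrDl; lra.
have lmn : l / 2 + m * n / 2 = s ^+ 2 * (C / c + 4 * C ^+ 3 / c ^+ 3).
  by rewrite /l /n /m; field; rewrite gt_eqF.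
rewrite lmn in main.
have -> : k / s ^+ 2 * A = (c / 4 * A) / (s ^+ 2 * (C / c + 4 * C ^+ 3 / c ^+ 3)).
  by rewrite /k; move: (C / c + _) D0 => D D0; field; rewrite !gt_eqF.
by rewrite ler_pdivrMr ?mulr_gt0 ?exprn_gt0// [leRHS]mulrC.
Qed.

Lemma within_segment_comp a b (c d : R) f q : {within `[a, b], continuous q} ->
  (forall t, a <= t <= b -> c <= q t <= d) -> {within `[c, d], continuous f} ->
  {within `[a, b], continuous (fun t => f (q t))}.
Proof.
move=> /within_segmentP qc qI /within_segmentP fc; apply/within_segmentP => t tI e e0.
have [r r0 Hr] := fc _ (qI t tI) e e0.
have [r' r'0 Hr'] := qc t tI (r / 2) (divr_gt0 r0 (ltr0Sn R 1)).
exists r' => // s sI st; apply: Hr; first exact: qI.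
by apply: le_lt_trans (Hr' s sI st) _; lra.
Qed.

(** The substitution [u = y t], [du = G (y t) dt] turns the integral of [H^2] up to [b] into that of
    [G H^2] along [y], up to the time [tb] at which [y] reaches [b]. The second factor [G] is
    bounded below by [c], and the integral from [tb] to [t1] is nonnegative. *)
Lemma Rintegral_time_change (G H y : R -> R) (t0 t1 b c : R) :
  0 <= c -> t0 < t1 ->
  {within `[t0, t1], continuous y} ->
  (forall t, t0 < t < t1 -> is_derive t 1 y (G (y t))) ->
  (forall t, t0 <= t <= t1 -> 0 < G (y t)) ->
  {within `[t0, t1], continuous (fun t => G (y t))} ->
  (forall u, y t0 <= u <= b -> c <= G u) ->
  y t0 < b <= y t1 -> {within `[y t0, y t1], continuous H} ->
  c * \int[mu]_(u in `[y t0, b]) (H u ^+ 2) <=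
  \int[mu]_(t in `[t0, t1]) ((G (y t) * H (y t)) ^+ 2).
Proof.
move=> c0 t01 yc yd Gy0 Gyc cG /andP[y0b by1] Hc.
have ymono s t : t0 <= s -> s <= t -> t <= t1 -> y s <= y t.
  move=> t0s st tt1; apply: (@le_of_is_derive _ _ _ y (fun t => G (y t))) => //.
  - exact: within_segment_subset yc.
  - by move=> r /andP[sr rt]; apply: yd; rewrite (le_lt_trans t0s sr) (lt_le_trans rt tt1).
  - move=> r /andP[/ltW sr /ltW rt]; apply/ltW/Gy0.
    by rewrite (le_trans t0s sr) (le_trans rt tt1).
have [tb] : exists2 tb, tb \in `[t0, t1]%R & y tb = b.
  apply: IVT => //; first exact: ltW.
  by rewrite ge_min (ltW y0b) /= le_max by1 orbT.
rewrite in_itv /= => /andP[t0b bt1] ytb.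
have t0b' : t0 < tb.
  by rewrite lt_neqAle t0b andbT; apply/eqP => e; move: y0b; rewrite -ytb e ltxx.
have y01 : y t0 <= y t1 by apply: ymono => //; exact: ltW.
have Hcc := clamp_continuous y01 Hc.
(* Clamping provides a primitive on an open neighbourhood of the range of [y], so that two-sided
   derivatives are available at its ends. *)
have [K Kd] : exists K : R -> R, forall u, y t0 - 1 < u < y t1 + 1 ->
    is_derive u 1 K (H (clamp (y t0) (y t1) u) ^+ 2).
  by apply: antiderivative => u; apply: cvgM; exact: Hcc.
have yI t : t0 <= t <= t1 -> y t0 <= y t <= y t1.
  by move=> /andP[t0t tt1]; rewrite !ymono.
have Hyc := within_segment_comp yc yI Hc.
have GHc : {within `[t0, t1], continuous (fun t => G (y t) * H (y t))}.
  exact: within_continuousM.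
have tbs f : {within `[t0, t1], continuous f} -> {within `[t0, tb], continuous f}.
  exact: within_segment_subset.
have K1 : \int[mu]_(u in `[y t0, b]) (H u ^+ 2) = K b - K (y t0).
  have bI u : y t0 <= u <= b -> y t0 <= u <= y t1.
    by move=> /andP[-> ub]; exact: le_trans by1.
  have Kd' u : y t0 <= u <= b -> is_derive u 1 K (H u ^+ 2).
    move=> uI; rewrite -{2}(clamp_id (bI u uI)); apply: Kd.
    by have /andP[? ?] := bI u uI; apply/andP; split; lra.
  apply: Rintegral_FTC2 => //.
  - exact: within_segment_subset (within_continuous2 Hc).
  - exact: is_derive_within_continuous Kd'.
  - by move=> u /andP[/ltW u1 /ltW u2]; apply: Kd'; rewrite u1.
have K2 : \int[mu]_(t in `[t0, tb]) (G (y t) * H (y t) ^+ 2) = K b - K (y t0).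
  have yI' t : t0 <= t <= tb -> y t0 <= y t <= y t1.
    by move=> /andP[h1 h2]; apply: yI; rewrite h1 (le_trans h2 bt1).
  have Kyd t : t0 < t < tb -> is_derive t 1 (K \o y) (G (y t) * H (y t) ^+ 2).
    move=> /andP[h1 h2].
    have tI : t0 <= t <= tb by rewrite !ltW.
    have := yI' t tI => yI''.
    have Kdt : is_derive (y t) 1 K (H (y t) ^+ 2).
      rewrite -{2}(clamp_id yI''); apply: Kd.
      by have /andP[? ?] := yI''; apply/andP; split; lra.
    have ydt : is_derive t 1 y (G (y t)) by apply: yd; rewrite h1 (lt_le_trans h2 bt1).
    by have := is_derive1_comp Kdt ydt; rewrite mulrC.
  rewrite -ytb; apply: (@Rintegral_FTC2 _ _ (K \o y)) => //.
  - by apply: tbs; apply: within_continuousM => //; exact: within_continuous2.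
  - have Kw : {within `[y t0, y t1], continuous K}.
      apply: (@is_derive_within_continuous _ _ _ (fun u => H (clamp (y t0) (y t1) u) ^+ 2)).
      by move=> u /andP[? ?]; apply: Kd; apply/andP; split; lra.
    exact: tbs (within_segment_comp yc yI Kw).
rewrite K1 -K2 -RintegralZl//; last first.
  by apply/within_integrable/tbs/within_continuousM => //; exact: within_continuous2.
apply: (@le_trans _ _ (\int[mu]_(t in `[t0, tb]) ((G (y t) * H (y t)) ^+ 2))).
  apply: le_Rintegral => //.
  - apply/within_integrable/tbs/within_continuousZ/within_continuousM => //.
    exact: within_continuous2.
  - exact/within_integrable/tbs/within_continuous2.
  move=> t; rewrite /= in_itv /= => /andP[h1 h2].
  have cGt : c <= G (y t).
    by apply: cG; rewrite -ytb !ymono// (le_trans h2 bt1).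
  have G0 : 0 < G (y t) by apply: Gy0; rewrite h1 (le_trans h2 bt1).
  rewrite exprMn mulrA; apply: ler_wpM2r; first exact: sqr_ge0.
  by rewrite expr2 ler_wpM2r// ltW.
rewrite /Rintegral; apply: fine_le.
- apply: integrable_fin_num => //; exact/within_integrable/tbs/within_continuous2.
- apply: integrable_fin_num => //; exact/within_integrable/within_continuous2.
apply: ge0_subset_integral => //=.
- by apply/measurable_EFinP; apply: subspace_continuous_measurable_fun => //; exact: within_continuous2.
- by move=> t _; rewrite lee_fin sqr_ge0.
- by move=> t /=; rewrite !in_itv /= => /andP[-> h]; exact: le_trans h bt1.
Qed.

End segment_integrals.

(** * Combinations of the basis functions *)

Section basis_functions.
Context {R : realType}.
Local Notation mu := (@lebesgue_measure R).
Implicit Types (f : R -> R) (a b : R).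

Lemma within_continuous_sum a b (I : Type) (s : seq I) (f : I -> R -> R) :
  (forall i, {within `[a, b], continuous (f i)}) ->
  {within `[a, b], continuous (fun u => \sum_(i <- s) f i u)}.
Proof.
move=> fc; elim: s => [|i s IH].
  have -> : (fun u => \sum_(i <- [::]) f i u) = cst 0.
    by apply/funext => u; rewrite big_nil.
  by move=> u; exact: cvg_cst.
have -> : (fun u => \sum_(j <- i :: s) f j u) = (fun u => f i u + \sum_(j <- s) f j u).
  by apply/funext => u; rewrite big_cons.
exact: within_continuousD.
Qed.

Lemma Rintegral_sum a b (I : Type) (s : seq I) (f : I -> R -> R) :
  (forall i, {within `[a, b], continuous (f i)}) ->
  \int[mu]_(u in `[a, b]) (\sum_(i <- s) f i u) =
  \sum_(i <- s) \int[mu]_(u in `[a, b]) f i u.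
Proof.
move=> fc; elim: s => [|i s IH].
  rewrite big_nil; transitivity (\int[mu]_(_ in `[a, b]) (0 : R)).
    by apply: eq_Rintegral => u _; rewrite big_nil.
  by rewrite Rintegral_cst// mul0r.
rewrite big_cons -IH -RintegralD//; last 2 first.
- exact: within_integrable.
- exact/within_integrable/within_continuous_sum.
by apply: eq_Rintegral => u _; rewrite big_cons.
Qed.

Lemma class_C2_quot_within (x0 x1 : R) f : class_C_within `[x0, x1] 2 f ->
  forall j, (j < 2)%N -> forall u, x0 <= u <= x1 ->
  quot_within `[x0, x1] (deriven_within `[x0, x1] j f) u -->
  deriven_within `[x0, x1] j.+1 f u.
Proof. by move=> [fd _] j j2 u uI; exact: fd. Qed.

Lemma class_C2_continuous (x0 x1 : R) f : class_C_within `[x0, x1] 2 f ->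
  forall j, (j < 2)%N ->
  {within `[x0, x1], continuous (deriven_within `[x0, x1] j f)}.
Proof.
move=> fC j j2; apply: quot_within_continuous => u uI.
exact: (class_C2_quot_within fC j2 uI).
Qed.

(** Off the closed support a whole neighbourhood avoids it, and the derivative along the segment
    sees only nearby points. Thus the derivatives of the [phi_k] inherit the short supports. *)
Lemma deriven_within_supp (x0 x1 : R) f j u : x0 < x1 -> x0 <= u <= x1 ->
  ~ supp_in `[x0, x1] f u -> deriven_within `[x0, x1] j f u = 0.
Proof.
move=> x01; elim: j u => [|j IH] u uI.
  move=> nsupp; apply/eqP/negPn/negP => fu0; apply: nsupp.
  by apply: subset_closure; split.
move=> nsupp; apply: (derive_withinE x01 uI); apply/quot_withinP => e e0.
have /closed_openC op : closed (supp_in `[x0, x1] f) by exact: closed_closure.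
have [d /= d0 Hd] : nbhs u (~` supp_in `[x0, x1] f) by exact: op.
exists d => // s sI sd; have sn : ~ supp_in `[x0, x1] f s by apply: Hd; rewrite /= distrC.
change (`|deriven_within `[x0, x1] j f s - deriven_within `[x0, x1] j f u
  - 0 * (s - u)| <= e * `|s - u|).
rewrite (IH u)// (IH s)// mul0r !subrr normr0.
by rewrite mulr_ge0// ltW.
Qed.

Section family.
Variables (M : nat) (x0 x1 : R) (phi : 'I_M -> R -> R).
Hypothesis x01 : x0 < x1.
Hypothesis phiC : forall k, class_C_within `[x0, x1] 2 (phi k).
Implicit Types beta : 'cV[R]_M.

Local Notation dphi := (fun k => deriven_within `[x0, x1] 1 (phi k)).

Lemma gbeta_quot_within beta u : x0 <= u <= x1 ->
  quot_within `[x0, x1] (gbeta phi beta) u --> gbeta dphi beta u.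
Proof.
move=> uI; rewrite /quot_within /gbeta.
have -> : (fun s => (\sum_(k < M) beta k ord0 * phi k s - \sum_(k < M) beta k ord0 * phi k u) / (s - u))
  = (fun s => \sum_(k < M) beta k ord0 * ((phi k s - phi k u) / (s - u))).
  apply/funext => s; rewrite -sumrB mulr_suml; apply: eq_bigr => k _; ring.
apply: cvg_big => [|k _]; first exact: add_continuous.
apply: cvgM; first exact: cvg_cst.
exact: (class_C2_quot_within (phiC k) _ uI).
Qed.

Lemma gbeta_continuous beta : {within `[x0, x1], continuous (gbeta phi beta)}.
Proof. by apply: quot_within_continuous => u uI; exact: gbeta_quot_within. Qed.

Lemma gbeta_derive_within beta u : x0 <= u <= x1 ->
  derive_within `[x0, x1] (gbeta phi beta) u = gbeta dphi beta u.
Proof. by move=> uI; apply: derive_withinE => //; exact: gbeta_quot_within. Qed.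

Lemma gbeta_is_derive beta u : x0 < u < x1 ->
  is_derive u 1 (gbeta phi beta) (gbeta dphi beta u).
Proof.
move=> /[dup] uI /andP[/ltW h1 /ltW h2].
apply: (quot_within_is_derive (nbhs_segment uI)); apply: gbeta_quot_within.
by rewrite h1.
Qed.

Lemma gbeta_dphi_continuous beta : {within `[x0, x1], continuous (gbeta dphi beta)}.
Proof.
apply: within_continuous_sum => k; apply: within_continuousZ.
exact: class_C2_continuous.
Qed.

Lemma gbeta_lipschitz beta : exists K : R, forall u v,
  x0 <= u <= x1 -> x0 <= v <= x1 ->
  `|gbeta phi beta u - gbeta phi beta v| <= K * `|u - v|.
Proof.
have [K K0 HK] := within_segment_bounded (@gbeta_dphi_continuous beta).
exists K; apply: (is_derive_lipschitz (@gbeta_continuous beta) (@gbeta_is_derive beta)).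
by move=> t /andP[/ltW h1 /ltW h2]; apply: HK; rewrite h1.
Qed.

Lemma gbeta_sqr_le (psi : 'I_M -> R -> R) beta (B u : R) :
  \sum_(k < M) `|psi k u| ^+ 2 <= B ->
  gbeta psi beta u ^+ 2 <= B * dotv beta beta.
Proof.
move=> psiB; have := cauchy_schwarz beta (\col_k psi k u).
have -> : dotv beta (\col_k psi k u) = gbeta psi beta u.
  by apply: eq_bigr => k _; rewrite mxE.
move=> /le_trans; apply; rewrite mulrC ler_wpM2r ?dotv_ge0//.
apply: le_trans psiB; apply: ler_sum => k _.
by rewrite mxE -expr2 real_normK ?num_real.
Qed.

(* Only the [k] with [u] in the [k]-th support contribute at [u]. *)
Lemma local_support_integral (psi : 'I_M -> R -> R) (S : 'I_M -> set R)
    beta (B L a b : R) :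
  (forall k, {within `[a, b], continuous (psi k)}) ->
  (forall k, measurable (S k)) -> (forall k, mu (S k) <= L%:E)%E -> 0 <= B ->
  (forall u, a <= u <= b -> forall k, ~ S k u -> psi k u = 0) ->
  (forall u, a <= u <= b -> \sum_(k < M) `|psi k u| ^+ 2 <= B) ->
  \int[mu]_(u in `[a, b]) (gbeta psi beta u ^+ 2) <= B * L * dotv beta beta.
Proof.
move=> psic mS SL B0 psi0 psiB.
have gc : {within `[a, b], continuous (fun u => gbeta psi beta u ^+ 2)}.
  apply: within_continuous2; apply: within_continuous_sum => k.
  exact: within_continuousZ.
rewrite -lee_fin /Rintegral fineK; last exact/integrable_fin_num/within_integrable.
apply: (@le_trans _ _ (\int[mu]_(u in `[a, b])
   (\sum_(k < M) (B * beta k ord0 ^+ 2)%:E * (\1_(S k) u)%:E))%E).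
  apply: ge0_le_integral => //.
  - by move=> u _; rewrite lee_fin sqr_ge0.
  - by apply/measurable_EFinP; apply: subspace_continuous_measurable_fun.
  - apply: emeasurable_sum => k; apply: measurable_funeM; apply/measurable_EFinP.
    by apply: measurable_indic; exact: mS.
  move=> u uI; under eq_bigr do rewrite -EFinM.
  rewrite sumEFin lee_fin.
  (* Coefficients whose support misses [u] are set to zero before Cauchy-Schwarz, so that
     integrating in [u] weighs each [beta_k^2] by the measure of [S k] and not by the length of the
     segment. *)
  pose beta' : 'cV[R]_M := \col_k (beta k ord0 * \1_(S k) u).
  have -> : gbeta psi beta u = gbeta psi beta' u.
    apply: eq_bigr => k _; rewrite mxE indicE; case: (boolP (u \in S k)) => [_|].
      by rewrite mulr1.
    by move/negP; rewrite inE => nS; rewrite (psi0 u uI k nS) !mulr0.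
  apply: le_trans (gbeta_sqr_le _ (psiB u uI)) _.
  rewrite /dotv mulr_sumr; apply: ler_sum => k _.
  rewrite !mxE indicE; by case: (_ \in _); rewrite ?(mulr1, mulr0).
rewrite ge0_integral_sum//; last 2 first.
- by move=> k; apply: measurable_funeM; apply/measurable_EFinP; apply: measurable_indic; exact: mS.
- move=> k u _; rewrite -EFinM lee_fin; apply: mulr_ge0; last by rewrite indicE ler0n.
  by apply: mulr_ge0 => //; exact: sqr_ge0.
have -> : B * L * dotv beta beta = \sum_(k < M) (B * beta k ord0 ^+ 2) * L.
  by rewrite /dotv mulr_sumr; apply: eq_bigr => k _; ring.
rewrite -sumEFin; apply: lee_sum => k _.
rewrite ge0_integralZl_EFin//; last 2 first.
- by apply/measurable_EFinP; apply: measurable_indic; exact: mS.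
- by apply: mulr_ge0 => //; exact: sqr_ge0.
rewrite [leRHS]EFinM; apply: lee_wpmul2l; rewrite ?lee_fin.
  by apply: mulr_ge0 => //; exact: sqr_ge0.
rewrite integral_indic//; last exact: mS.
apply: le_trans (SL k).
apply: le_measure; rewrite ?inE; [|exact: mS|exact: subIsetl].
by apply: measurableI => //; exact: mS.
Qed.

Lemma phi_continuous k : {within `[x0, x1], continuous (phi k)}.
Proof. exact: (@class_C2_continuous _ _ _ (phiC k) 0). Qed.

Lemma gram_form beta :
  dotv beta (gram `[x0, x1] phi *m beta) =
  \int[mu]_(u in `[x0, x1]) (gbeta phi beta u ^+ 2).
Proof.
have -> : \int[mu]_(u in `[x0, x1]) (gbeta phi beta u ^+ 2) =
  \int[mu]_(u in `[x0, x1]) (\sum_(k < M) \sum_(l < M)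
     (beta k ord0 * beta l ord0) * (phi k u * phi l u)).
  apply: eq_Rintegral => u _; rewrite expr2 /gbeta mulr_suml.
  by apply: eq_bigr => k _; rewrite mulr_sumr; apply: eq_bigr => l _; ring.
have cc k l : {within `[x0, x1], continuous (fun u => phi k u * phi l u)}.
  by apply: within_continuousM; exact: phi_continuous.
rewrite Rintegral_sum => [|k]; last first.
  by apply: within_continuous_sum => l; exact: within_continuousZ.
apply: eq_bigr => k _; rewrite Rintegral_sum => [|l]; last exact: within_continuousZ.
rewrite mxE mulr_sumr; apply: eq_bigr => l _.
rewrite mxE RintegralZl//; last exact: within_integrable.
by rewrite mulrAC mulrA.
Qed.

Lemma gram_form_ge c : (forall a, eigenvalue (gram `[x0, x1] phi) a -> c <= a) ->
  forall beta, c * dotv beta beta <= \int[mu]_(u in `[x0, x1]) (gbeta phi beta u ^+ 2).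
Proof.
move=> Hc beta; rewrite -gram_form; apply: dotv_form_ge => //.
apply/matrixP => k l; rewrite !mxE; apply: eq_Rintegral => u _; exact: mulrC.
Qed.

(** Pointwise the squared combination is at most [B |beta|^2], so cutting off the two end pieces
    costs at most [B |beta|^2] times their length. In the application [B = O(M)] and condition (a)
    makes this loss a small fraction of [c]. *)
Lemma gram_restrict_ge c B a b beta :
  (forall a, eigenvalue (gram `[x0, x1] phi) a -> c <= a) ->
  (forall u, x0 <= u <= x1 -> \sum_(k < M) `|phi k u| ^+ 2 <= B) ->
  x0 <= a -> a < b -> b <= x1 ->
  (c - B * ((a - x0) + (x1 - b))) * dotv beta beta <=
  \int[mu]_(u in `[a, b]) (gbeta phi beta u ^+ 2).
Proof.
move=> Hc HB x0a ab bx1.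
have gc := within_continuous2 (@gbeta_continuous beta).
have [K Kd] : exists K : R -> R, forall u, x0 - 1 < u < x1 + 1 ->
    is_derive u 1 K (gbeta phi beta (clamp x0 x1 u) ^+ 2).
  apply: antiderivative => u.
  have gcl := clamp_continuous (ltW x01) (@gbeta_continuous beta).
  by apply: cvgM; exact: gcl.
have Kd' u : x0 <= u <= x1 -> is_derive u 1 K (gbeta phi beta u ^+ 2).
  move=> uI; rewrite -{2}(clamp_id uI); apply: Kd.
  by have /andP[? ?] := uI; apply/andP; split; lra.
have KI s t : x0 <= s -> s < t -> t <= x1 ->
    \int[mu]_(u in `[s, t]) (gbeta phi beta u ^+ 2) = K t - K s.
  move=> x0s st tx1; apply: Rintegral_FTC2 => //.
  - exact: within_segment_subset gc.
  - apply: within_segment_subset (is_derive_within_continuous Kd') => //.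
  - move=> u /andP[/ltW su /ltW ut]; apply: Kd'.
    by rewrite (le_trans x0s su) (le_trans ut tx1).
have Kl s t : x0 <= s -> s <= t -> t <= x1 -> K t - K s <= B * dotv beta beta * (t - s).
  move=> x0s st tx1; have st1 := le_trans st tx1; have st2 := le_trans x0s st.
  have := @is_derive_lipschitz _ x0 x1 (B * dotv beta beta) K _
    (is_derive_within_continuous Kd') _ _ t s.
  rewrite (ger0_norm (_ : 0 <= t - s)) ?subr_ge0// st1 st2 x0s tx1 => H.
  apply: le_trans (ler_norm _) _; apply: H => //.
  - by move=> u /andP[/ltW h1 /ltW h2]; apply: Kd'; rewrite h1.
  - move=> u /andP[/ltW h1 /ltW h2]; rewrite ger0_norm ?sqr_ge0//.
    by apply: gbeta_sqr_le; apply: HB; rewrite h1.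
have ax1 : a <= x1 by exact: le_trans (ltW ab) bx1.
have x0b : x0 <= b by exact: le_trans x0a (ltW ab).
have G := gram_form_ge Hc beta; rewrite KI// in G.
rewrite KI//; have k1 := Kl x0 a (lexx _) x0a ax1; have k2 := Kl b x1 x0b bx1 (lexx _).
move: G k1 k2; move: (dotv beta beta) (K x0) (K x1) (K a) (K b) => D k0 k1 ka kb.
by rewrite mulrBl; lra.
Qed.

End family.
End basis_functions.

Arguments gbeta_continuous {R M x0 x1 phi} phiC beta.
Arguments gbeta_dphi_continuous {R M x0 x1 phi} phiC beta.
Arguments phi_continuous {R M x0 x1 phi} phiC k.

(** * The gradient of the trajectory *)

Section trajectory_gradient.
Context {R : realType}.
Variables (M : nat) (x0 x1 : R) (phi : 'I_M -> R -> R).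
Hypothesis x01 : x0 < x1.
Hypothesis phiC : forall k, class_C_within `[x0, x1] 2 (phi k).
Variables (delta al : R).
Hypothesis hdelta : 0 < delta < 1 / 2.
Implicit Types (beta : 'cV[R]_M) (x y : R -> R).
Local Notation D0 := (`[x0, x1]).

Let dd : delta < 1 - delta.
Proof. by case/andP: hdelta; lra. Qed.

(** [traj] selects some solution by [xget]; Lipschitz uniqueness identifies it with any solution at
    hand. *)
Lemma trajE beta y t : is_traj phi D0 delta al beta y ->
  delta <= t <= 1 - delta -> traj phi D0 delta al beta t = y t.
Proof.
move=> yt tI; rewrite /traj patchE mem_set; last by rewrite /= in_itv.
case: xgetP => [x _ xt|/(_ y)]; last by case.
have [K HK] := gbeta_lipschitz phiC beta.
apply: (@ode_solution_unique _ delta (1 - delta) D0 (gbeta phi beta) K x y delta) => //.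
- exact: xt.1.
- exact: yt.1.
- by rewrite lexx ltW.
- by rewrite xt.2 yt.2.
Qed.

Lemma traj_out beta t : ~~ (delta <= t <= 1 - delta) ->
  traj phi D0 delta al beta t = 0.
Proof.
move=> tI; rewrite /traj patchE memNset//= in_itv /=; exact/negP.
Qed.

Lemma is_traj_itv beta y t : is_traj phi D0 delta al beta y ->
  delta <= t <= 1 - delta -> x0 <= y t <= x1.
Proof.
by move=> [ys _] tI; have := (ys t tI).1; rewrite /= in_itv.
Qed.

Lemma gbeta_traj_continuous beta y : is_traj phi D0 delta al beta y ->
  {within `[delta, 1 - delta], continuous (fun t => gbeta phi beta (y t))}.
Proof.
move=> yt; apply: (@within_segment_comp _ delta (1 - delta) x0 x1 (gbeta phi beta) y (ode_solution_continuous yt.1)).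
  by move=> t tI; exact: (is_traj_itv yt tI).
exact: gbeta_continuous.
Qed.

(* A zero of the right-hand side met by the trajectory would be a constant
   solution through the same point. *)
Lemma gbeta_traj_gt0 beta y : is_traj phi D0 delta al beta y ->
  0 < gbeta phi beta al ->
  forall t, delta <= t <= 1 - delta -> 0 < gbeta phi beta (y t).
Proof.
move=> yt al0 t /[dup] tI /andP[dt td]; rewrite ltNge; apply/negP => neg.
have [s] : exists2 s, s \in `[delta, t]%R & gbeta phi beta (y s) = 0.
  apply: (@IVT _ (fun s => gbeta phi beta (y s))) => //.
    exact: within_segment_subset (gbeta_traj_continuous yt).
  by rewrite yt.2 ge_min neg orbT /= le_max (ltW al0).
rewrite in_itv /= => /andP[ds st] ys0.
have sI : delta <= s <= 1 - delta by rewrite ds (le_trans st td).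
have [K HK] := gbeta_lipschitz phiC beta.
have cs : ode_solution `[delta, 1 - delta] D0 (gbeta phi beta) (cst (y s)).
  move=> r rI; split; first by have := is_traj_itv yt sI.
  rewrite ys0; apply/quot_withinP => e e0; exists 1 => // q _ _.
  by rewrite mul0r !subrr normr0 mulr_ge0// ltW.
have := @ode_solution_unique _ delta (1 - delta) D0 (gbeta phi beta) K y _ s HK yt.1 cs sI erefl delta.
rewrite lexx ltW// => /(_ isT) ey.
by move: al0; rewrite -yt.2 ey /= ys0 ltxx.
Qed.

Lemma traj_monotone beta y : is_traj phi D0 delta al beta y ->
  0 < gbeta phi beta al ->
  forall s t, delta <= s -> s <= t -> t <= 1 - delta -> y s <= y t.
Proof.
move=> yt al0 s t ds st td.
apply: (@le_of_is_derive _ _ _ y (fun t => gbeta phi beta (y t))) => //.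
- exact: within_segment_subset (ode_solution_continuous yt.1).
- move=> r /andP[sr rt]; apply: (ode_solution_is_derive yt.1).
  by rewrite (le_lt_trans ds sr) (lt_le_trans rt td).
- move=> r /andP[/ltW sr /ltW rt]; apply/ltW/(gbeta_traj_gt0 yt al0).
  by rewrite (le_trans ds sr) (le_trans rt td).
Qed.

Lemma gbeta_delta beta h k u :
  gbeta phi (beta + h *: delta_mx k ord0) u = gbeta phi beta u + h * phi k u.
Proof.
rewrite /gbeta; have -> : h * phi k u = \sum_(i < M) (if i == k then h * phi k u else 0).
  by rewrite -big_mkcond /= big_pred1_eq.
rewrite -big_split /=; apply: eq_bigr => i _; rewrite !mxE eqxx andbT mulrDl.
by case: eqP => [->|_]; rewrite ?mulr1// mulr0 mul0r.
Qed.

Lemma near_is_derive (f g : R -> R) (u l r : R) : 0 < r ->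
  (forall s, `|s - u| < r -> f s = g s) -> is_derive u 1 f l -> is_derive u 1 g l.
Proof.
move=> r0 fg /is_deriveP H; apply/is_deriveP => e /H[d d0 Hd].
exists (Num.min d r); first by rewrite lt_min d0.
move=> s; rewrite lt_min => /andP[sd sr].
by rewrite -!fg ?subrr ?normr0// Hd.
Qed.

Lemma gbeta_range_gt0 beta y : is_traj phi D0 delta al beta y ->
  0 < gbeta phi beta al ->
  forall u, al <= u <= y (1 - delta) -> 0 < gbeta phi beta u.
Proof.
move=> yt al0 u /andP[alu uy].
have [t] : exists2 t, t \in `[delta, 1 - delta]%R & y t = u.
  apply: IVT; [exact: ltW|exact: ode_solution_continuous yt.1|].
  by rewrite yt.2 ge_min alu le_max uy orbT.
by rewrite in_itv /= => tI <-; exact: gbeta_traj_gt0 tI.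
Qed.

(** [ode_perturbation] needs fields defined and bounded on the whole line with a positive lower
    bound, whereas [gbeta phi beta] is known to be positive only on the range of [y]. The positivity
    is extended slightly past [y1], to [e < x1], and the fields are clamped to [[al, e]]; for small
    [h] the perturbed solutions stay in [[al, e]], where clamping changes nothing, and so are
    genuine trajectories in [D0]. *)
Lemma traj_grad_formula beta y : is_traj phi D0 delta al beta y ->
  0 < gbeta phi beta al -> x0 < al -> y (1 - delta) < x1 ->
  forall k : 'I_M, exists Psi : R -> R,
    [/\ forall u, al <= u <= y (1 - delta) ->
          is_derive u 1 Psi (phi k u / gbeta phi beta u ^+ 2),
        Psi al = 0 &
        forall t, delta <= t <= 1 - delta ->
          traj_grad phi D0 delta al beta t k ord0 = gbeta phi beta (y t) * Psi (y t)].
Proof.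
move=> yt al0 x0al; set y1 := y (1 - delta) => y1x k.
pose G := gbeta phi beta.
have aly1 : al <= y1 by rewrite -yt.2; apply: (traj_monotone yt al0) => //; exact: ltW.
have yI t : delta <= t <= 1 - delta -> al <= y t <= y1.
  move=> /andP[dt td]; rewrite -{1}yt.2.
  by rewrite (traj_monotone yt al0)//= (traj_monotone yt al0).
have Gy1 : 0 < G y1 by apply: (gbeta_range_gt0 yt al0); rewrite aly1 lexx.
have x0y1 : x0 <= y1 <= x1 by rewrite (le_trans (ltW x0al) aly1) ltW.
have [d d0 Gd] : exists2 d : R, 0 < d & forall u, x0 <= u <= x1 -> `|u - y1| < d ->
    `|G u - G y1| <= G y1 / 2.
  have /within_segmentP := gbeta_continuous phiC beta; apply => //.
  by rewrite divr_gt0.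
(* The first term keeps [G] above [G y1 / 2] between [y1] and [e], the second keeps [e] below
   [x1]. *)
pose e := Num.min (y1 + d / 2) ((y1 + x1) / 2).
have y1e : y1 < e by rewrite lt_min; apply/andP; split; [rewrite ltrDl divr_gt0|lra].
have ex1 : e < x1.
  by rewrite gt_min; apply/orP; right; lra.
have ed : e <= y1 + d / 2 by rewrite ge_min lexx.
have ale : al < e by exact: le_lt_trans aly1 y1e.
have Gale : {within `[al, e], continuous G}.
  exact: (within_segment_subset (ltW x0al) (ltW ex1) (@gbeta_continuous _ _ _ _ _ phiC beta)).
have Gpos u : al <= u <= e -> 0 < G u.
  move=> /andP[alu ue]; have [uy|yu] := leP u y1.
    by apply: (gbeta_range_gt0 yt al0); rewrite alu.
  have := Gd u; rewrite (le_trans (ltW x0al) alu) (le_trans ue (ltW ex1)) => /(_ isT).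
  rewrite gtr0_norm ?subr_gt0// => H.
  have : u - y1 < d by lra.
  by move=> /H; rewrite ler_norml => /andP[+ _]; lra.
have [c cI cmin] := EVT_min (ltW ale) Gale.
have [N N0 GN] := within_segment_bounded Gale.
pose f u := G (clamp al e u).
pose ph u := phi k (clamp al e u).
have clI u : al <= clamp al e u <= e by apply: clamp_itv; exact: ltW.
have clD u : x0 <= clamp al e u <= x1.
  by have /andP[h1 h2] := clI u; rewrite (le_trans (ltW x0al) h1) (le_trans h2 (ltW ex1)).
have fc : continuous f by exact: clamp_continuous (ltW ale) Gale.
have pc : {within `[al, e], continuous (phi k)}.
  exact: (within_segment_subset (ltW x0al) (ltW ex1) (phi_continuous phiC k)).
have phc : continuous ph by exact: clamp_continuous (ltW ale) pc.
have [K K0 phK] := within_segment_bounded pc.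
have Gc0 : 0 < G c by apply: Gpos; move: cI; rewrite in_itv.
have fb u : G c <= f u <= N.
  rewrite /f; apply/andP; split.
    by apply: cmin; rewrite in_itv /= clI.
  by apply: le_trans (GN _ (clI u)); exact: ler_norm.
have [L [U [z [Psi [h0 [C [h00 alLU Psid Psial Hz]]]]]]] :=
  @ode_perturbation R f ph (G c) N K al delta (1 - delta) fc phc Gc0 fb (fun u => phK _ (clI u)) (ltW dd).
have z00 : `|0 : R| < h0 by rewrite normr0.
have [LG HLG] := gbeta_lipschitz phiC beta.
(* The two functions solve the clamped equation on the whole line, which is Lipschitz because
   [clamp] is 1-Lipschitz; [LG0] supplies the sign of the constant. *)
have z0y t : delta <= t <= 1 - delta -> z 0 t = y t.
  have LG0 : 0 <= LG.
    have := HLG x0 x1; rewrite !lexx (ltW x01) => /(_ isT isT) /(le_trans (normr_ge0 _)).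
    by rewrite pmulr_lge0// normr_gt0 subr_eq0 lt_eqF.
  apply: (@ode_solution_unique _ delta (1 - delta) setT f LG (z 0) y delta).
  - move=> u v _ _; apply: le_trans (HLG _ _ (clD u) (clD v)) _.
    by rewrite ler_wpM2l// clamp_lipschitz.
  - move=> s sI; split => //; apply: is_derive_quot_within.
    by have [/(_ 0 z00)[_ _ _]] := Hz s sI; rewrite mul0r addr0.
  - move=> s sI; split => //; have := (yt.1 s sI).2.
    rewrite /f clamp_id//; have /andP[h1 h2] := yI s sI.
    by rewrite h1 (le_trans h2 (ltW y1e)).
  - by rewrite lexx ltW.
  - have [/(_ 0 z00)[_ -> _ _] _] := Hz delta ltac:(by rewrite lexx ltW).
    by rewrite yt.2.
have y1U u : al <= u <= y1 -> L < u < U.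
  move=> /andP[h1 h2]; have /andP[La aU] := alLU; rewrite (lt_le_trans La h1) /=.
  apply: le_lt_trans h2 _.
  have dI : delta <= 1 - delta <= 1 - delta by rewrite lexx ltW.
  by have [/(_ 0 z00)[/andP[_ +] _ _ _] _] := Hz _ dI; rewrite z0y.
exists Psi; split => //.
  move=> u /[dup] uI /andP[h1 h2].
  have := Psid u (y1U u uI); rewrite /f /ph clamp_id//.
  by rewrite h1 (le_trans h2 (ltW y1e)).
move=> t tI; have [_ Dz] := Hz t tI.
have C0 : 0 < `|C| + 1 by rewrite ltr_wpDl.
(* The drift [|z h t - z 0 t| <= C |h|] must not exceed the gap [e - y1]; [|C| + 1] is a positive
   substitute for [C]. *)
pose h1 := Num.min h0 ((e - y1) / (`|C| + 1)).
have h10 : 0 < h1 by rewrite lt_min h00 divr_gt0// subr_gt0.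
have zt h : `|h| < h1 ->
    is_traj phi D0 delta al (beta + h *: delta_mx k ord0) (z h).
  rewrite lt_min => /andP[hh0]; rewrite ltr_pdivlMr// => hC.
  have zI s : delta <= s <= 1 - delta -> al <= z h s <= e.
    move=> sI; have [/(_ h hh0)[/andP[-> _] _ zz _] _] := Hz s sI => /=.
    rewrite z0y// in zz; have /andP[_ ys] := yI s sI.
    have : C * `|h| <= `|h| * (`|C| + 1).
      by rewrite mulrDr mulr1 mulrC; have := ler_norm C; have := normr_ge0 h; nra.
    by move: zz; rewrite ler_norml => /andP[_]; lra.
  split; last by have [/(_ h hh0)[]] := Hz delta ltac:(by rewrite lexx ltW).
  move=> s sI; have zs := zI s sI; split.
    rewrite /= in_itv /=; have /andP[g1 g2] := zs.
    by rewrite (le_trans (ltW x0al) g1) (le_trans g2 (ltW ex1)).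
  apply: is_derive_quot_within.
  have [/(_ h hh0)[_ _ _ +] _] := Hz s sI.
  by rewrite /f /ph clamp_id// gbeta_delta.
have Dt : is_derive (0 : R) 1
    (fun h => traj phi D0 delta al (beta + h *: delta_mx k ord0) t) (G (y t) * Psi (y t)).
  have -> : G (y t) = f (z 0 t).
    rewrite z0y// /f clamp_id//; have /andP[g1 g2] := yI t tI.
    by rewrite g1 (le_trans g2 (ltW y1e)).
  rewrite -z0y//; apply: near_is_derive h10 _ Dz => h; rewrite subr0 => hh.
  by rewrite (trajE (zt h hh) tI).
by rewrite mxE derive1E; have [_ ->] := Dt.
Qed.

Lemma traj_grad_out beta t k : ~~ (delta <= t <= 1 - delta) ->
  traj_grad phi D0 delta al beta t k ord0 = 0.
Proof.
move=> tI; rewrite mxE.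
have -> : (fun h => traj phi D0 delta al (beta + h *: delta_mx k ord0) t) = cst 0.
  by apply/funext => h; rewrite traj_out.
exact: derive1_cst.
Qed.

End trajectory_gradient.

(** * The law of the observation time *)

Section random_times_moments.
Context {R : realType}.
Local Notation mu := (@lebesgue_measure R).

(* Outside [A] the measure [nu] is completed by [c * mu], so that the
   comparison of measures holds on all measurable sets. *)
Lemma ge0_integral_le_of_measure_le (nu : {measure set (measurableTypeR R) -> \bar R})
    (c : R) (A : set (measurableTypeR R)) (f : measurableTypeR R -> \bar R) :
  0 <= c -> measurable A ->
  (forall B : set (measurableTypeR R), measurable B ->
    (c%:E * mu (B `&` A) <= nu B)%E) ->
  measurable_fun setT f -> (forall x, 0 <= f x)%E ->
  (c%:E * \int[mu]_(x in A) f x <= \int[nu]_x f x)%E.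
Proof.
move=> c0 mA cnu mf f0.
have mAc : measurable (~` A) by exact: measurableC.
pose cmu := mscale (NngNum c0) mu.
pose rho := mrestr cmu mAc.
have m12 S : measurable S -> (cmu S <= measure_add nu rho S)%E.
  move=> mS; rewrite measure_addE /rho /mrestr /cmu /mscale /=.
  have -> : mu S = (mu (S `&` A) + mu (S `&` ~` A))%E.
    rewrite -measureU.
    - by rewrite -setIUr setUv setIT.
    - exact: measurableI.
    - exact: measurableI.
    - by rewrite setIACA setICr setI0.
  rewrite ge0_muleDr ?measure_ge0//.
  by apply: leeD => //; exact: cnu.
have mfA : measurable_fun A f by exact: measurable_funTS.
have H1 : (\int[cmu]_(x in A) f x = c%:E * \int[mu]_(x in A) f x)%E.
  by rewrite ge0_integral_mscale.
rewrite -H1; apply: le_trans (ge0_le_measure_integral m12 mA f0 mf) _.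
rewrite ge0_integral_measure_add//.
(* The completing measure does not charge [A], so it leaves the integral over [A] unchanged. *)
have rA0 : rho A = 0%E by rewrite /rho /mrestr setICr /cmu /mscale measure0 mule0.
rewrite (null_set_integral mA mfA rA0) adde0.
by apply: ge0_subset_integral => //.
Qed.

Lemma density_ge (A B : set R) (f : R -> R) (c : R) :
  measurable A -> measurable B -> B `<=` A -> measurable_fun A f -> 0 <= c ->
  (forall t, A t -> c <= f t) ->
  (c%:E * mu B <= \int[mu]_(u in B) (f u)%:E)%E.
Proof.
move=> mA mB BA mf c0 cf.
rewrite -integral_cst//; apply: ge0_le_integral => //.
- by apply/measurable_EFinP; exact: measurable_funS mA BA mf.
- by move=> u /BA /cf; rewrite lee_fin.
Qed.

(** Conditioning divides by the probability of [[s, t]], which is at most 1 and therefore preserves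
    a lower bound on the density; it is positive because the density is at least [c] there and
    [s < t]. *)
Lemma cond_law_ge d (Omega : measurableType d) (P : probability Omega R)
    (T : {RV P >-> R}) d' (Omega' : measurableType d') (P' : probability Omega' R)
    (T' : {RV P' >-> R}) (f : R -> R) (c s t : R) :
  s < t -> `[s, t] `<=` `[0, 1] -> 0 < c -> has_density_on `[0, 1] T f ->
  (forall u, `[0, 1] u -> c <= f u) -> has_cond_law T `[s, t] T' ->
  forall B, measurable B -> (c%:E * mu (B `&` `[s, t]) <= distribution P' T' B)%E.
Proof.
move=> st st01 c0 [mf fE] cf law B mB.
have low C : measurable C -> C `<=` `[s, t] ->
    (c%:E * mu C <= distribution P T C)%E.
  move=> mC Cst; rewrite fE// setIidl; last exact: subset_trans Cst st01.
  apply: (@density_ge `[0, 1]) => //; [exact: subset_trans Cst st01|exact: ltW].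
have pfin C : measurable C -> distribution P T C \is a fin_num.
  by move=> mC; rewrite fin_num_measure.
have pfin' : distribution P' T' B \is a fin_num by rewrite fin_num_measure.
have mBA : measurable (B `&` `[s, t]) by exact: measurableI.
have A1 : fine (distribution P T `[s, t]) <= 1.
  by rewrite -lee_fin fineK ?pfin//; exact: probability_le1.
have A0 : 0 < fine (distribution P T `[s, t]).
  rewrite -lte_fin fineK ?pfin//; apply: lt_le_trans (low _ _ _) => //.
  by rewrite lebesgue_measure_itv /= lte_fin st -EFinD -EFinM lte_fin mulr_gt0// subr_gt0.
rewrite -[leRHS]fineK// law//.
apply: le_trans (low _ mBA (@subIsetr _ _ _)) _.
by rewrite -[leLHS]fineK ?pfin// lee_fin ler_pdivlMr// ler_piMr// fine_ge0.
Qed.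

Lemma bounded_integrable_prob d (Omega : measurableType d) (P : probability Omega R)
    (f : Omega -> R) (K : R) : measurable_fun setT f -> (forall w, `|f w| <= K) ->
  P.-integrable setT (EFin \o f).
Proof.
move=> mf fK; apply: measurable_bounded_integrable => //.
  by rewrite -ge0_fin_numE ?fin_num_measure.
exists K; split; first exact: num_real.
by move=> N KN w _; exact: le_trans (fK w) (ltW KN).
Qed.

(** The entries are [fine] of expectations and would degenerate to 0 at infinite values; boundedness
    of the [V k] makes every product integrable, so the square can be expanded under the
    integral. *)
Lemma second_moment_form d (Omega : measurableType d) (P : probability Omega R)
    (T : {RV P >-> R}) (M : nat) (V : 'I_M -> R -> R) (beta : 'cV[R]_M) :
  (forall k, measurable_fun setT (V k)) ->
  (forall k, exists K : R, forall t, `|V k t| <= K) ->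
  (dotv beta ((\matrix_(k, l) fine 'E_P[fun w => (V k (T w) * V l (T w))%R]) *m beta))%:E
  = (\int[P]_w ((\sum_(k < M) beta k ord0 * V k (T w)) ^+ 2)%:E)%E.
Proof.
move=> mV bV.
have iV k l : P.-integrable setT (fun w => (V k (T w) * V l (T w))%:E).
  have [K HK] := bV k; have [K' HK'] := bV l.
  apply: (@bounded_integrable_prob _ _ _ (fun w => V k (T w) * V l (T w)) (K * K')).
    by apply: measurable_funM; apply: measurableT_comp => //; exact: mV.
  by move=> w; rewrite normrM; apply: ler_pM.
have sq w : (((\sum_(k < M) beta k ord0 * V k (T w)) ^+ 2)%:E =
    \sum_(k < M) \sum_(l < M) (beta k ord0 * beta l ord0)%:E * (V k (T w) * V l (T w))%:E)%E.
  rewrite expr2 mulr_suml -sumEFin; apply: eq_bigr => k _.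
  rewrite mulr_sumr -sumEFin; apply: eq_bigr => l _.
  by rewrite -EFinM; congr (_%:E); ring.
under eq_integral do rewrite sq.
have iVZ k l : P.-integrable setT
    (fun w => ((beta k ord0 * beta l ord0)%:E * (V k (T w) * V l (T w))%:E)%E).
  exact: integrableZl.
rewrite integral_sum//; last by move=> k; exact: integrable_sum.
rewrite -sumEFin; apply: eq_bigr => k _.
rewrite integral_sum// mxE mulr_sumr -sumEFin; apply: eq_bigr => l _.
rewrite integralZl// mxE unlock (mulrC (fine _)) mulrA EFinM fineK//.
exact: integrable_fin_num.
Qed.

End random_times_moments.

(** * Lower bound for the quadratic form of [Gstar] *)

Section coercivity.
Context {R : realType}.
Local Notation mu := (@lebesgue_measure R).

Lemma le_Rintegral_within (a b : R) (f g : R -> R) :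
  {within `[a, b], continuous f} -> {within `[a, b], continuous g} ->
  (forall u, a <= u <= b -> f u <= g u) ->
  \int[mu]_(u in `[a, b]) f u <= \int[mu]_(u in `[a, b]) g u.
Proof.
move=> fc gc fg; apply: le_Rintegral; [by []|exact: within_integrable|exact: within_integrable|].
by move=> u /=; rewrite in_itv /= => /fg.
Qed.

(** [interpolation_ineq] for [q = h / G^2], where [h] and [G] are the combinations with coefficients
    [eta] and [beta]. The constant [k] is produced before [M] and all the data, which enter only
    through bounds; this is the uniformity behind the rate. *)
Lemma weighted_interpolation (cg Cg B0 B1 L cl : R) :
  0 < cg -> 0 <= Cg -> 0 <= B0 -> 0 <= B1 -> 0 <= L -> 0 < cl ->
  exists2 k : R, 0 < k & forall (M : nat) (x0 x1 al b s : R)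
    (phi : 'I_M -> R -> R) (beta eta : 'cV[R]_M) (H : R -> R),
  let dphi := fun k => deriven_within `[x0, x1] 1 (phi k) in
  x0 < x1 -> (forall k, class_C_within `[x0, x1] 2 (phi k)) ->
  x0 < al -> al < b -> b < x1 -> 1 <= s ->
  (forall u, al <= u <= b -> cg <= gbeta phi beta u <= Cg) ->
  (forall u, al <= u <= b -> `|gbeta dphi beta u| <= Cg) ->
  (forall u, x0 <= u <= x1 -> \sum_(k < M) `|phi k u| ^+ 2 <= B0 * s) ->
  (forall u, x0 <= u <= x1 -> \sum_(k < M) `|dphi k u| ^+ 2 <= B1 * s ^+ 3) ->
  (forall k, mu (supp_in `[x0, x1] (phi k)) <= (L / s)%:E)%E ->
  (forall a, eigenvalue (gram `[x0, x1] phi) a -> cl <= a) ->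
  B0 * s * ((al - x0) + (x1 - b)) <= cl / 2 ->
  {within `[al, b], continuous H} -> H al = 0 ->
  (forall u, al < u < b ->
     is_derive u 1 H (gbeta phi eta u / gbeta phi beta u ^+ 2)) ->
  k / s ^+ 2 * dotv eta eta <= \int[mu]_(u in `[al, b]) (H u ^+ 2).
Proof.
move=> cg0 Cg0 B00 B10 L0 cl0.
pose Cg1 := Cg + 1.
have Cg10 : 0 < Cg1 by rewrite ltr_wpDl.
pose c := cl / 2 / Cg1 ^+ 4.
have c0 : 0 < c by rewrite !divr_gt0// exprn_gt0.
(* [Ca], [Cb], [Cc] bound the integral of [q^2], that of [q'^2] over [s^2], and [q(b)^2] over [s],
   all per unit of [|eta|^2]. In [Cb], [q' = h'/G^2 - 2 h G'/G^3] is squared by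
   [(x - y)^2 <= 2 x^2 + 2 y^2], whence the factors 2 and 8. *)
pose Ca := B0 * L / cg ^+ 4.
pose Cb := 2 * (B1 * L) / cg ^+ 4 + 8 * (B0 * L) * Cg ^+ 2 / cg ^+ 6.
pose Cc := B0 / cg ^+ 4.
have Ca0 : 0 <= Ca by rewrite /Ca !mulr_ge0// invr_ge0 exprn_ge0// ltW.
have Cb0 : 0 <= Cb.
  by rewrite /Cb addr_ge0// !mulr_ge0// ?invr_ge0 ?exprn_ge0// ltW.
have Cc0 : 0 <= Cc by rewrite /Cc !mulr_ge0// invr_ge0 exprn_ge0// ltW.
pose C := Ca + Cb + Cc + 1.
have C0 : 0 < C by rewrite /C ltr_wpDl// addr_ge0// addr_ge0.
have [k k0 Hk] := interpolation_ineq c0 C0.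
exists k => // M x0 x1 al b s phi beta eta H dphi x01 phiC x0al alb bx1 s1
  GB dGB phiB dphiB supp eig small Hc Hal Hd.
have s0 : 0 < s by exact: lt_le_trans s1.
pose G := gbeta phi beta. pose dG := gbeta dphi beta.
pose h := gbeta phi eta. pose dh := gbeta dphi eta.
have sub (f : R -> R) : {within `[x0, x1], continuous f} -> {within `[al, b], continuous f}.
  by move=> fc; exact: (within_segment_subset (ltW x0al) (ltW bx1) fc).
have Gc : {within `[al, b], continuous G} by exact/sub/gbeta_continuous.
have hc : {within `[al, b], continuous h} by exact/sub/gbeta_continuous.
have dGc : {within `[al, b], continuous dG} by exact/sub/gbeta_dphi_continuous.
have dhc : {within `[al, b], continuous dh} by exact/sub/gbeta_dphi_continuous.
have inD u : al <= u <= b -> x0 <= u <= x1.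
  by move=> /andP[h1 h2]; rewrite (le_trans (ltW x0al) h1) (le_trans h2 (ltW bx1)).
have G0 u : al <= u <= b -> 0 < G u.
  by move=> /GB/andP[+ _]; exact: lt_le_trans.
have Gn0 u : al <= u <= b -> G u != 0 by move=> /G0 /lt0r_neq0.
have G2n0 u : al <= u <= b -> G u ^+ 2 != 0 by move=> /Gn0; exact: expf_neq0.
have G3n0 u : al <= u <= b -> G u ^+ 3 != 0 by move=> /Gn0; exact: expf_neq0.
pose q u := h u * (G u ^+ 2)^-1.
pose dq u := dh u * (G u ^+ 2)^-1 - 2 * (h u * dG u * (G u ^+ 3)^-1).
have G2c := within_continuous2 Gc.
have G3c : {within `[al, b], continuous (fun u => G u ^+ 3)}.
  have -> : (fun u => G u ^+ 3) = (fun u => G u * G u ^+ 2) by apply/funext => u; rewrite exprS.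
  exact: within_continuousM.
have qc : {within `[al, b], continuous q}.
  by apply: within_continuousM => //; exact: within_continuousV.
have dqc : {within `[al, b], continuous dq}.
  apply: within_continuousB.
    by apply: within_continuousM => //; exact: within_continuousV.
  apply: within_continuousZ; apply: within_continuousM.
    exact: within_continuousM.
  exact: within_continuousV.
have qd u : al < u < b -> is_derive u 1 q (dq u).
  move=> /[dup] uab' /andP[/ltW h1 /ltW h2].
  have uab : al <= u <= b by rewrite h1.
  have uD : x0 < u < x1.
    by case/andP: uab' => g1 g2; rewrite (lt_trans x0al g1) (lt_trans g2 bx1).
  have dhu : is_derive u 1 h (dh u) by exact: gbeta_is_derive.
  have dGu : is_derive u 1 G (dG u) by exact: gbeta_is_derive.
  have dG2 : is_derive u 1 (fun v => G v ^+ 2) (2 * (G u * dG u)).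
    apply: (is_derive_eq (is_deriveM dGu dGu)); rewrite /GRing.scale /=; ring.
  have dG2V := @is_deriveV R (fun v => G v ^+ 2) u _ 1 (G2n0 u uab) dG2.
  apply: (is_derive_eq (is_deriveM dhu dG2V)).
  by rewrite /GRing.scale /= /dq; field; exact: Gn0.
have phic k' : {within `[al, b], continuous (phi k')} by exact/sub/phi_continuous.
have dphic k' : {within `[al, b], continuous (dphi k')} by exact/sub/class_C2_continuous.
have mS k' : measurable (supp_in `[x0, x1] (phi k')).
  by apply: closed_measurable; exact: closed_closure.
have int_h : \int[mu]_(u in `[al, b]) (h u ^+ 2) <= B0 * L * dotv eta eta.
  (* The growth [s] of the pointwise bound cancels against the support length [L / s]. *)
  have -> : B0 * L = B0 * s * (L / s) by field; rewrite gt_eqF.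
  apply: (@local_support_integral _ M phi _ eta _ _ al b phic mS supp).
  - by rewrite mulr_ge0// ltW.
  - by move=> u uI k' nS; apply: (@deriven_within_supp _ x0 x1 _ 0); rewrite ?inD.
  - by move=> u /inD; exact: phiB.
have int_dh : \int[mu]_(u in `[al, b]) (dh u ^+ 2) <= B1 * L * s ^+ 2 * dotv eta eta.
  have -> : B1 * L * s ^+ 2 = B1 * s ^+ 3 * (L / s) by field; rewrite gt_eqF.
  apply: (@local_support_integral _ M dphi _ eta _ _ al b dphic mS supp).
  - by rewrite mulr_ge0// exprn_ge0// ltW.
  - by move=> u uI k' nS; apply: (@deriven_within_supp _ x0 x1 _ 1); rewrite ?inD.
  - by move=> u /inD; exact: dphiB.
have int_low : cl / 2 * dotv eta eta <= \int[mu]_(u in `[al, b]) (h u ^+ 2).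
  have := gram_restrict_ge x01 phiC eta eig phiB (ltW x0al) alb (ltW bx1); apply: le_trans.
  by apply: ler_wpM2r; [exact: dotv_ge0|lra].
have A0 := dotv_ge0 eta.
have GV u n : al <= u <= b -> (G u ^+ n)^-1 <= (cg ^+ n)^-1.
  move=> uI; rewrite lef_pV2 ?posrE ?exprn_gt0 ?G0//.
  apply: lerXn2r; [by rewrite nnegrE ltW|by rewrite nnegrE ltW ?G0|].
  by have /andP[] := GB u uI.
have GV0 u n : al <= u <= b -> 0 <= (G u ^+ n)^-1.
  by move=> uI; rewrite invr_ge0 exprn_ge0// ltW// G0.
have q2 u : q u ^+ 2 = h u ^+ 2 * (G u ^+ 4)^-1.
  by rewrite /q exprMn exprVn -exprM.
apply: (Hk al b q dq H s (dotv eta eta)) => //.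
- apply/andP; split.
    apply: (@le_trans _ _ (\int[mu]_(u in `[al, b]) ((Cg1 ^+ 4)^-1 * h u ^+ 2))).
      rewrite RintegralZl//; last exact/within_integrable/within_continuous2.
      have -> : c * dotv eta eta = (Cg1 ^+ 4)^-1 * (cl / 2 * dotv eta eta) by rewrite /c; ring.
      by rewrite ler_wpM2l// invr_ge0 exprn_ge0// ltW.
    apply: le_Rintegral_within.
    + exact/within_continuousZ/within_continuous2.
    + exact: within_continuous2.
    move=> u uI; rewrite q2 mulrC ler_wpM2l ?sqr_ge0//.
    rewrite lef_pV2 ?posrE ?exprn_gt0 ?G0//.
    apply: lerXn2r; [by rewrite nnegrE ltW ?G0|by rewrite nnegrE ltW|].
    by have /andP[_ h2] := GB u uI; apply: le_trans h2 _; rewrite lerDl.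
  apply: (@le_trans _ _ (\int[mu]_(u in `[al, b]) ((cg ^+ 4)^-1 * h u ^+ 2))).
    apply: le_Rintegral_within.
    + exact: within_continuous2.
    + exact/within_continuousZ/within_continuous2.
    by move=> u uI; rewrite q2 mulrC ler_wpM2r ?sqr_ge0// GV.
  rewrite RintegralZl//; last exact/within_integrable/within_continuous2.
  apply: (@le_trans _ _ (Ca * dotv eta eta)).
    have -> : Ca * dotv eta eta = (cg ^+ 4)^-1 * (B0 * L * dotv eta eta) by rewrite /Ca; ring.
    by rewrite ler_wpM2l// invr_ge0 exprn_ge0// ltW.
  by rewrite ler_wpM2r// /C; lra.
- apply: (@le_trans _ _ (\int[mu]_(u in `[al, b])
     (2 * (cg ^+ 4)^-1 * dh u ^+ 2 + 8 * Cg ^+ 2 * (cg ^+ 6)^-1 * h u ^+ 2))).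
    apply: le_Rintegral_within.
    + exact: within_continuous2.
    + by apply: within_continuousD; exact/within_continuousZ/within_continuous2.
    move=> u uI.
    have e1 : dq u ^+ 2 <= 2 * ((G u ^+ 4)^-1 * dh u ^+ 2)
        + 8 * (dG u ^+ 2 * (G u ^+ 6)^-1 * h u ^+ 2).
      rewrite -subr_ge0.
      have -> : 2 * ((G u ^+ 4)^-1 * dh u ^+ 2)
        + 8 * (dG u ^+ 2 * (G u ^+ 6)^-1 * h u ^+ 2) - dq u ^+ 2
        = (dh u * (G u ^+ 2)^-1 + 2 * (h u * dG u * (G u ^+ 3)^-1)) ^+ 2.
        by rewrite /dq; field; exact: Gn0.
      exact: sqr_ge0.
    apply: le_trans e1 _; apply: lerD.
      by rewrite -mulrA ler_wpM2l// ler_wpM2r ?sqr_ge0// GV.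
    have -> : 8 * Cg ^+ 2 * (cg ^+ 6)^-1 * h u ^+ 2 = 8 * (Cg ^+ 2 * (cg ^+ 6)^-1 * h u ^+ 2).
      by ring.
    apply: ler_wpM2l => //; apply: ler_wpM2r; first exact: sqr_ge0.
    apply: ler_pM; rewrite ?sqr_ge0 ?GV ?GV0//.
    rewrite -[leLHS]ger0_norm ?sqr_ge0// normrX; apply: lerXn2r; rewrite ?nnegrE//.
    exact: dGB.
  have dh2c := within_continuous2 dhc. have h2c := within_continuous2 hc.
  rewrite RintegralD//; last 2 first.
  + exact/within_integrable/within_continuousZ.
  + exact/within_integrable/within_continuousZ.
  rewrite !RintegralZl//; last 2 first.
  + exact: within_integrable.
  + exact: within_integrable.
  apply: (@le_trans _ _ (Cb * s ^+ 2 * dotv eta eta)).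
    have -> : Cb * s ^+ 2 * dotv eta eta =
      2 * (cg ^+ 4)^-1 * (B1 * L * s ^+ 2 * dotv eta eta)
      + 8 * Cg ^+ 2 * (cg ^+ 6)^-1 * (s ^+ 2 * (B0 * L * dotv eta eta)).
      by rewrite /Cb; ring.
    apply: lerD; apply: ler_wpM2l => //.
    + by rewrite mulr_ge0// invr_ge0 exprn_ge0// ltW.
    + by rewrite !mulr_ge0// ?invr_ge0 ?exprn_ge0// ltW.
    + apply: le_trans int_h _; rewrite -[leLHS]mul1r ler_wpM2r//.
        by rewrite !mulr_ge0.
      by rewrite -(expr1n R 2) lerXn2r// nnegrE ltW.
  by rewrite ler_wpM2r// ler_wpM2r ?sqr_ge0// /C; lra.
- have bI : al <= b <= b by rewrite lexx ltW.
  rewrite q2; apply: (@le_trans _ _ (Cc * s * dotv eta eta)).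
    have -> : Cc * s * dotv eta eta = (B0 * s * dotv eta eta) * (cg ^+ 4)^-1 by rewrite /Cc; ring.
    apply: ler_pM; rewrite ?sqr_ge0 ?GV ?GV0//.
    by apply: gbeta_sqr_le; apply: phiB; exact: inD.
  by rewrite ler_wpM2r// ler_wpM2r ?ltW// /C; lra.
Qed.

End coercivity.

Section gstar_form.
Context {R : realType}.
Local Notation mu := (@lebesgue_measure R).

(** The form at [eta] is the second moment of [G (y T) H (y T)], with [H] the [eta]-combination of
    the primitives [Psi k]. The bound [c'] on the law replaces the expectation by a time integral,
    and the change of variable [u = y t] then costs a factor [c]. *)
Lemma Gstar_form_ge (M : nat) (x0 x1 al b delta c c' : R) (phi : 'I_M -> R -> R)
    (beta eta : 'cV[R]_M) (y : R -> R) d (Omega : measurableType d)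
    (P : probability Omega R) (T : {RV P >-> R}) :
  0 < delta < 1 / 2 ->
  x0 < x1 -> (forall k, class_C_within `[x0, x1] 2 (phi k)) ->
  is_traj phi `[x0, x1] delta al beta y ->
  x0 < al -> al < b -> b <= y (1 - delta) -> y (1 - delta) < x1 ->
  0 < c -> (forall u, al <= u <= b -> c <= gbeta phi beta u) -> 0 <= c' ->
  (forall B : set R, measurable B ->
     (c'%:E * mu (B `&` `[delta, (1 - delta)%R]) <= distribution P T B)%E) ->
  exists H : R -> R,
    [/\ {within `[al, b], continuous H}, H al = 0,
     (forall u, al < u < b ->
        is_derive u 1 H (gbeta phi eta u / gbeta phi beta u ^+ 2)) &
     c' * (c * \int[mu]_(u in `[al, b]) (H u ^+ 2)) <=
     dotv eta (Gstar phi `[x0, x1] delta al P T beta *m eta)].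
Proof.
move=> hdelta x01 phiC yt x0al alb by1 y1x c0 cG c'0 law.
have dd : delta < 1 - delta by case/andP: hdelta; lra.
pose G := gbeta phi beta.
have al0 : 0 < G al by apply: lt_le_trans (cG al _) => //; rewrite lexx ltW.
have aly1 : al <= y (1 - delta) by exact: le_trans (ltW alb) by1.
have yI t : delta <= t <= 1 - delta -> al <= y t <= y (1 - delta).
  move=> /andP[dt td]; rewrite -{1}yt.2.
  by rewrite !(traj_monotone phiC hdelta yt al0)//= ltW.
have /choice[Psi HPsi] := traj_grad_formula x01 phiC hdelta yt al0 x0al y1x.
pose H u := \sum_(k < M) eta k ord0 * Psi k u.
have Hd u : al <= u <= y (1 - delta) -> is_derive u 1 H (gbeta phi eta u / G u ^+ 2).
  move=> uI; have -> : H = \sum_(k < M) (eta k ord0 \*: Psi k).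
    by apply/funext => v; rewrite fct_sumE.
  have -> : gbeta phi eta u / G u ^+ 2 = \sum_(k < M) (eta k ord0 *: (phi k u / G u ^+ 2)).
    by rewrite /gbeta mulr_suml; apply: eq_bigr => k _; rewrite /GRing.scale /= mulrA.
  by apply: is_derive_sum => k; apply: is_deriveZ; have [HP _ _] := HPsi k; exact: HP.
have Hc : {within `[al, y (1 - delta)], continuous H} by exact: is_derive_within_continuous Hd.
pose V k t := traj_grad phi `[x0, x1] delta al beta t k ord0.
(* Off [[delta, 1 - delta]] every trajectory is 0 by convention and so is the gradient;
   measurability and boundedness on the whole line thus follow from continuity on the segment. *)
have VE k : V k = (fun t => G (y t) * Psi k (y t)) \_ `[delta, 1 - delta].
  apply/funext => t; rewrite patchE; case: ifPn => [|].
    by rewrite inE /= in_itv /= => tI; have [_ _ HP] := HPsi k; exact: HP.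
  rewrite notin_setE /= in_itv /= => /negP tI.
  exact: (traj_grad_out x0 x1 phi al beta k tI).
have Psic k : {within `[al, y (1 - delta)], continuous (Psi k)}.
  by apply: (is_derive_within_continuous (f := fun u => phi k u / gbeta phi beta u ^+ 2));
    have [HP _ _] := HPsi k; exact: HP.
have GPc k : {within `[delta, 1 - delta], continuous (fun t => G (y t) * Psi k (y t))}.
  apply: within_continuousM; first exact: (gbeta_traj_continuous phiC yt).
  exact: (within_segment_comp (ode_solution_continuous yt.1) yI (Psic k)).
have mV k : measurable_fun setT (V k).
  rewrite VE; apply/(measurable_restrictT _ _).1 => //.
  by apply: subspace_continuous_measurable_fun => //; exact: GPc.
have bV k : exists K : R, forall t, `|V k t| <= K.
  have [K K0 HK] := within_segment_bounded (GPc k); exists K => t.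
  rewrite VE patchE; case: ifPn => [|_]; last by rewrite normr0.
  by rewrite inE /= in_itv /=; exact: HK.
exists H; split.
- exact: within_segment_subset Hc.
- by rewrite /H big1// => k _; have [_ -> _] := HPsi k; rewrite mulr0.
- by move=> u /andP[/ltW h1 /ltW h2]; apply: Hd; rewrite h1 (le_trans h2 by1).
have GE : Gstar phi `[x0, x1] delta al P T beta =
    \matrix_(k, l) fine ('E_P[fun w => (V k (T w) * V l (T w))%R])%E.
  apply/matrixP => k l; rewrite !mxE; congr (fine ('E_P[_])%E); apply/funext => w.
  by rewrite !mxE big_ord1 /V !mxE.
rewrite -lee_fin GE second_moment_form//.
pose F t := (\sum_(k < M) eta k ord0 * V k t) ^+ 2.
have mF : measurable_fun setT (fun t => (F t)%:E).
  apply/measurable_EFinP; apply: measurable_funX; apply: measurable_sum => k.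
  by apply: measurable_funM => //; exact: mV.
have F0 t : (0 <= (F t)%:E)%E by rewrite lee_fin sqr_ge0.
(* [T] as a variable into [measurableTypeR R], the type carrying [lebesgue_measure] *)
have mT : @measurable_fun _ _ Omega (measurableTypeR R) setT T.
  by move=> mD Y mY; exact: (@measurable_funP _ _ _ _ setT T mD Y mY).
pose T' : {mfun Omega >-> measurableTypeR R} := @mfun_Sub _ _ Omega (measurableTypeR R) T (mem_set mT).
have mF' : @measurable_fun _ _ (measurableTypeR R) _ setT (fun t => (F t)%:E) by exact: mF.
have -> : (\int[P]_w ((\sum_(k < M) eta k ord0 * V k (T w))%R ^+ 2)%:E =
    \int[distribution P T']_t (F t)%:E)%E.
  by rewrite (ge0_integral_distribution T' mF' F0).
have := @ge0_integral_le_of_measure_le R (distribution P T') c' `[delta, 1 - delta]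
  (fun t => (F t)%:E) c'0 _ law mF' F0.
move=> /(_ (measurable_itv _)); apply: le_trans.
rewrite EFinM lee_wpmul2l ?lee_fin//.
have GHc : {within `[delta, 1 - delta], continuous (fun t => G (y t) * H (y t))}.
  apply: within_continuousM; first exact: (gbeta_traj_continuous phiC yt).
  exact: (within_segment_comp (ode_solution_continuous yt.1) yI Hc).
have -> : (\int[mu]_(t in `[delta, (1 - delta)%R]) (F t)%:E =
    \int[mu]_(t in `[delta, (1 - delta)%R]) ((G (y t) * H (y t)) ^+ 2)%:E)%E.
  apply: eq_integral => t /[dup] tS; rewrite inE /= in_itv /= => tI; congr (_%:E); congr (_ ^+ 2).
  rewrite /H mulr_sumr; apply: eq_bigr => k _.
  by rewrite VE patchE tS; ring.
rewrite -[leRHS]fineK; last exact/integrable_fin_num/within_integrable/within_continuous2.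
rewrite lee_fin -yt.2; apply: (@Rintegral_time_change _ G) => //.
- exact: ltW.
- exact: ode_solution_continuous yt.1.
- by move=> t tI; exact: (ode_solution_is_derive yt.1).
- exact: (gbeta_traj_gt0 phiC hdelta yt al0).
- exact: (gbeta_traj_continuous phiC yt).
- by rewrite yt.2.
- by rewrite yt.2 alb.
- by rewrite yt.2.
Qed.

End gstar_form.

(** * A bound uniform in [M], and the passage to large [M] *)

Section uniform_bound.
Context {R : realType}.

(** [K] depends only on the seven constants, so taking [s = M] gives a genuine [O(M^2)]. *)
Lemma Gstar_opnorm_le (cg Cg B0 B1 L cl c' : R) :
  0 < cg -> 0 <= Cg -> 0 <= B0 -> 0 <= B1 -> 0 <= L -> 0 < cl -> 0 < c' ->
  exists2 K : R, 0 < K & forall (M : nat) (x0 x1 al b delta s : R)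
    (phi : 'I_M -> R -> R) (beta : 'cV[R]_M) (y : R -> R)
    d (Omega : measurableType d) (P : probability Omega R) (T : {RV P >-> R}),
  let dphi := fun k => deriven_within `[x0, x1] 1 (phi k) in
  0 < delta < 1 / 2 ->
  x0 < x1 -> (forall k, class_C_within `[x0, x1] 2 (phi k)) ->
  is_traj phi `[x0, x1] delta al beta y ->
  x0 < al -> al < b -> b <= y (1 - delta) -> y (1 - delta) < x1 -> 1 <= s ->
  (forall u, al <= u <= b -> cg <= gbeta phi beta u <= Cg) ->
  (forall u, al <= u <= b -> `|gbeta dphi beta u| <= Cg) ->
  (forall u, x0 <= u <= x1 -> \sum_(k < M) `|phi k u| ^+ 2 <= B0 * s) ->
  (forall u, x0 <= u <= x1 -> \sum_(k < M) `|dphi k u| ^+ 2 <= B1 * s ^+ 3) ->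
  (forall k, lebesgue_measure (supp_in `[x0, x1] (phi k)) <= (L / s)%:E)%E ->
  (forall a, eigenvalue (gram `[x0, x1] phi) a -> cl <= a) ->
  B0 * s * ((al - x0) + (x1 - b)) <= cl / 2 ->
  (forall B : set R, measurable B ->
     (c'%:E * lebesgue_measure (B `&` `[delta, (1 - delta)%R]) <=
      distribution P T B)%E) ->
  let G := Gstar phi `[x0, x1] delta al P T beta in
  G \in unitmx /\ 0 <= opnorm (invmx G) <= K * s ^+ 2.
Proof.
move=> cg0 Cg0 B00 B10 L0 cl0 c'0.
have [k k0 Hk] := weighted_interpolation cg0 Cg0 B00 B10 L0 cl0.
exists (c' * (cg * k))^-1; first by rewrite invr_gt0 !mulr_gt0.
move=> M x0 x1 al b delta s phi beta y d Omega P T dphi hdelta x01 phiC yt x0al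
  alb by1 y1x s1 GB dGB phiB dphiB supp eig small law G.
have s0 : 0 < s by exact: lt_le_trans s1.
have kap0 : 0 < c' * (cg * (k / s ^+ 2)) by rewrite !mulr_gt0// invr_gt0 exprn_gt0.
have coercive eta : c' * (cg * (k / s ^+ 2)) * dotv eta eta <= dotv eta (G *m eta).
  have cG u : al <= u <= b -> cg <= gbeta phi beta u by move=> /GB/andP[].
  have [H [Hc Hal Hd HG]] := Gstar_form_ge eta hdelta x01 phiC yt x0al alb by1 y1x
    cg0 cG (ltW c'0) law.
  apply: le_trans HG; rewrite -!mulrA.
  apply: ler_wpM2l; first exact: ltW.
  apply: ler_wpM2l; first exact: ltW.
  rewrite mulrA.
  apply: (Hk M x0 x1 al b s phi beta eta H) => //.
  exact: le_lt_trans by1 y1x.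
split; first exact: coercive_unitmx coercive.
have /andP[-> h] := opnorm_invmx_le kap0 coercive; apply: le_trans h _.
rewrite le_eqVlt; apply/orP; left; apply/eqP; field.
by rewrite !gt_eqF.
Qed.

Lemma ode_solution_increasing (a b : R) (A : set R) (f x : R -> R) :
  ode_solution `[a, b] A f x -> (forall u, A u -> 0 < f u) ->
  forall s t, a <= s -> s < t -> t <= b -> x s < x t.
Proof.
move=> xs f0 s t as_ st tb.
have xd r : r \in `]s, t[%R -> is_derive r 1 x (f (x r)).
  rewrite in_itv /= => /andP[sr rt]; apply: (ode_solution_is_derive xs).
  by rewrite (le_lt_trans as_ sr) (lt_le_trans rt tb).
have [r] := MVT st xd (within_segment_subset as_ tb (ode_solution_continuous xs)).
rewrite in_itv /= => /andP[sr rt] E; rewrite -subr_gt0 E mulr_gt0 ?subr_gt0//.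
apply: f0; apply: (xs r _).1; rewrite /= in_itv /=.
by rewrite (le_trans as_ (ltW sr)) (le_trans (ltW rt) tb).
Qed.

Lemma class_C_open_within (D : set R) p (f : R -> R) (a b : R) j :
  class_C_open D p f -> (j < p)%N -> `[a, b] `<=` D ->
  {within `[a, b], continuous f^`(j)}.
Proof.
move=> [fd _] jp abD; apply: derivable_within_continuous => u uab.
by apply: fd => //; apply: abD.
Qed.

Lemma near_infty_le_div (C e : R) : 0 < e -> \forall M \near \oo, C / M%:R <= e.
Proof.
move=> e0; near=> M.
have M0 : 0 < M%:R :> R by rewrite ltr0n; near: M; exact: nbhs_infty_gt.
rewrite ler_pdivrMr// mulrC -ler_pdivrMr//.
by near: M; exact: nbhs_infty_ger.
Unshelve. all: by end_near. Qed.

End uniform_bound.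

(** Invertibility is part of the conclusion because [invmx] returns a singular matrix unchanged, in
    which case the norm bound would say nothing about an inverse. *)
Theorem proposition3p1 (R : realType)
  (delta : R) (hdelta : 0 < delta < 1 / 2)
  (* the trajectory X = X_g *)
  (g X : R -> R) (D : set R) (p : nat) (hp : (3 <= p)%N)
  (hX : ode_solution `[0, 1] D g X)
  (* A1 *)
  (D_open : open D) (D_itv : is_interval D)
  (D_sub : `[X 0, X 1] `<=` D)
  (g_Cp : class_C_open D p g)
  (g_pos : forall u, D u -> 0 < g u)
  (* endpoints of D_0 *)
  (x0 x1 : nat -> R)
  (x01 : forall M, (0 < M)%N -> x0 M < x1 M)
  (* A2 *)
  (phi : forall M, 'I_M -> R -> R)
  (A2i : forall M, (0 < M)%N -> forall k : 'I_M,
     L2norm_on `[x0 M, x1 M] (phi M k) = 1)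
  (A2ii_union : forall M, (0 < M)%N ->
     \bigcup_(k in [set: 'I_M]) supp_in `[x0 M, x1 M] (phi M k)
       = `[x0 M, x1 M])
  (A2ii_length : exists C : R, \forall M \near \oo, forall k : 'I_M,
     (lebesgue_measure (supp_in `[x0 M, x1 M] (phi M k)) <= (C / M%:R)%:E)%E)
  (A2iii : forall M, (0 < M)%N -> forall k : 'I_M,
     class_C_within `[x0 M, x1 M] 2 (phi M k))
  (A2iv : forall j, (j <= 2)%N ->
     sup_bigO (fun M => `[x0 M, x1 M])
       (fun M u => \sum_(k < M)
          `|deriven_within `[x0 M, x1 M] j (phi M k) u| ^+ 2)
       (fun M => M%:R ^+ (1 + 2 * j)))
  (cl cu : R) (hc : 0 < cl <= cu)
  (A2v : forall M, (0 < M)%N -> forall a : R,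
     eigenvalue (gram `[x0 M, x1 M] (phi M)) a -> cl <= a <= cu)
  (bstar : forall M, 'cV[R]_M)
  (A2vi_exists : \forall M \near \oo, exists x : R -> R,
     is_traj (phi M) `[x0 M, x1 M] delta (X delta) (bstar M) x)
  (A2vi_traj :
     sup_bigO (fun _ => `[delta, 1 - delta])
       (fun M t => X t -
          traj (phi M) `[x0 M, x1 M] delta (X delta) (bstar M) t)
       (fun M => (M%:R ^+ (p + 1))^-1))
  (A2vi_g : forall j, (j <= 2)%N ->
     sup_bigO (fun _ => `[X delta, X (1 - delta)])
       (fun M u => derive1n j g u -
          deriven_within `[x0 M, x1 M] j (gbeta (phi M) (bstar M)) u)
       (fun M => M%:R ^+ j / M%:R ^+ p))
  (* A3; there are n.+1 observation times and T ord0 is T_1 *)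
  (d : measure_display) (Omega : measurableType d) (P : probability Omega R)
  (n : nat) (T : 'I_n.+1 -> {RV P >-> R})
  (T_indep : mutually_independent T)
  (fT : R -> R) (T_density : forall j, has_density_on `[0, 1] (T j) fT)
  (cl' cu' : R) (hc' : 0 < cl' <= cu')
  (fT_bounds : forall t, `[0, 1] t -> cl' <= fT t <= cu')
  (d' : measure_display) (Omega' : measurableType d')
  (P' : probability Omega' R) (Ttilde : {RV P' >-> R})
  (Ttilde_law : has_cond_law (T ord0) `[delta, 1 - delta] Ttilde)
  (* (a) and (b) *)
  (ha : (fun M => Num.max `|x0 M - X delta| `|x1 M - X (1 - delta)|)
          =o_\oo (fun M => (M%:R : R)^-1))
  (hb : (fun M => (M%:R : R) `^ (- (3 / 2)))
          =o_\oo (fun M => Num.min (x1 M - X (1 - delta)) (X delta - x0 M))) :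
  let G M := Gstar (phi M) `[x0 M, x1 M] delta (X delta) P' Ttilde (bstar M) in
  (\forall M \near \oo, G M \in unitmx) /\
  (fun M => opnorm (invmx (G M))) =O_\oo (fun M => (M%:R : R) ^+ 2).
Proof.
move=> G.
have /andP[d0 d12] := hdelta.
have dd : delta < 1 - delta by lra.
pose al := X delta; pose be := X (1 - delta).
have Xinc := ode_solution_increasing hX g_pos.
have albe : al < be by apply: Xinc => //; lra.
have al_be_D : `[al, be] `<=` D.
  apply: subset_trans D_sub => u /=; rewrite !in_itv /= => /andP[h1 h2].
  have X0 : X 0 < al by apply: Xinc => //; lra.
  have X1 : be < X 1 by apply: Xinc => //; lra.
  by rewrite (le_trans (ltW X0) h1) (le_trans h2 (ltW X1)).
have gc : {within `[al, be], continuous g}.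
  by apply: (class_C_open_within (j := 0) g_Cp) => //; exact: ltn_trans hp.
have dgc : {within `[al, be], continuous derive1n 1 g}.
  by apply: (class_C_open_within (j := 1) g_Cp) => //; exact: ltn_trans hp.
have [um umI gmin] := EVT_min (ltW albe) gc.
have m0 : 0 < g um by apply: g_pos; apply: al_be_D; exact: umI.
have [N0 N00 gN] := within_segment_bounded gc.
have [N1 N10 dgN] := within_segment_bounded dgc.
set m := g um in m0 gmin.
have [L0 HL] := A2ii_length.
have [B0 HB0] := A2iv 0 isT.
have [B1 HB1] := A2iv 1 isT.
have [C2 HC2] := A2vi_traj.
have [C0 HC0] := A2vi_g 0 isT.
have [C1 HC1] := A2vi_g 1 isT.
have /andP[cl0 _] := hc. have /andP[cl'0 _] := hc'.
(* Eventually [g_*] is within [m / 2] of [g], whose minimum is [m], and its derivative within 1 of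
   that of [g]; [Cg] dominates both upper bounds. *)
pose cg := m / 2. pose Cg := N0 + m + N1 + 1.
have cg0 : 0 < cg by rewrite divr_gt0.
have Cg0 : 0 <= Cg by rewrite /Cg; lra.
have [K K0 HK] := @Gstar_opnorm_le R cg Cg `|B0| `|B1| `|L0| cl cl' cg0 Cg0
  (normr_ge0 _) (normr_ge0 _) (normr_ge0 _) cl0 cl'0.
have law := @cond_law_ge R _ _ P (T ord0) _ _ P' Ttilde fT cl' delta (1 - delta) dd
  _ cl'0 (T_density ord0) (fun u uI => proj1 (andP (fT_bounds u uI))) Ttilde_law.
have st01 : `[delta, 1 - delta] `<=` `[0, 1 : R].
  move=> t /=; rewrite !in_itv /= => /andP[h1 h2].
  by clear - h1 h2 d0 d12; apply/andP; split; lra.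
have {}law := law st01.
(* Three gaps, [al - x0 M], [x1 M - be] and [be - b], will each be at most [e1 / M]; times [|B0| M]
   the total loss in the Gram bound is at most [3 cl / 8]. *)
pose e1 := cl / (8 * (`|B0| + 1)).
have e10 : 0 < e1 by rewrite divr_gt0// mulr_gt0// ltr_wpDl.
(* With this factor (b) gives a margin of at least [2 (|C2| + 1) M^-2], more than the trajectory
   error [|C2| M^-2]. *)
pose e2 := (2 * (`|C2| + 1))^-1.
have e20 : 0 < e2 by rewrite invr_gt0 mulr_gt0// ltr_wpDl.
have /eqoP/(_ e1 e10) Ha := ha.
have /eqoP/(_ e2 e20) Hb := hb.
have key : \forall M \near \oo, G M \in unitmx /\
    0 <= opnorm (invmx (G M)) <= K * M%:R ^+ 2.
  near=> M.
  have M0 : (0 < M)%N by near: M; exact: nbhs_infty_gt.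
  have s1 : 1 <= M%:R :> R by rewrite ler1n.
  have s0 : 0 < M%:R :> R by rewrite ltr0n.
  have [y yt] : exists x, is_traj (phi M) `[x0 M, x1 M] delta al (bstar M) x.
    by near: M; exact: A2vi_exists.
  have n1 : `|C2| / M%:R <= (be - al) / 2.
    by near: M; apply: near_infty_le_div; rewrite divr_gt0// subr_gt0.
  have n2 : `|C2| / M%:R <= e1 by near: M; exact: near_infty_le_div.
  have n3 : `|C0| / M%:R <= m / 2 by near: M; apply: near_infty_le_div; rewrite divr_gt0.
  have n4 : `|C1| / M%:R <= 1 by near: M; exact: near_infty_le_div.
  have hb1 : `|M%:R `^ (- (3 / 2))| <= e2 * `|Num.min (x1 M - be) (al - x0 M)|.
    by near: M; exact: Hb.
  have ha1 : `|Num.max `|x0 M - al| `|x1 M - be| | <= e1 * `|(M%:R)^-1|.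
    by near: M; exact: Ha.
  have traj1 : forall t, `[delta, 1 - delta] t ->
      `|X t - traj (phi M) `[x0 M, x1 M] delta (X delta) (bstar M) t|
      <= C2 * (M%:R ^+ (p + 1))^-1 by near: M; exact: HC2.
  have g1 : forall u, `[al, be] u ->
      `|g u - gbeta (phi M) (bstar M) u| <= C0 * (M%:R ^+ 0 / M%:R ^+ p).
    by near: M; exact: HC0.
  have dg1 : forall u, `[al, be] u -> `|derive1n 1 g u -
      deriven_within `[x0 M, x1 M] 1 (gbeta (phi M) (bstar M)) u|
      <= C1 * (M%:R ^+ 1 / M%:R ^+ p) by near: M; exact: HC1.
  have phi1 : forall u, `[x0 M, x1 M] u -> `|\sum_(k < M)
      `|deriven_within `[x0 M, x1 M] 0 (phi M k) u| ^+ 2| <= B0 * M%:R ^+ (1 + 2 * 0).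
    by near: M; exact: HB0.
  have dphi1 : forall u, `[x0 M, x1 M] u -> `|\sum_(k < M)
      `|deriven_within `[x0 M, x1 M] 1 (phi M k) u| ^+ 2| <= B1 * M%:R ^+ (1 + 2 * 1).
    by near: M; exact: HB1.
  have supp1 : forall k : 'I_M,
      (lebesgue_measure (supp_in `[x0 M, x1 M] (phi M k)) <= (L0 / M%:R)%:E)%E.
    by near: M; exact: HL.
  move: s1 s0 n1 n2 n3 n4 hb1 ha1 traj1 g1 dg1 phi1 dphi1 supp1.
  set s : R := M%:R => s1 s0 n1 n2 n3 n4 hb1 ha1 traj1 g1 dg1 phi1 dphi1 supp1.
  have x01M := x01 M M0.
  have phiC := A2iii M M0.
  have sV r q : (q <= r)%N -> (s ^+ r)^-1 <= (s ^+ q)^-1.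
    by move=> qr; rewrite lef_pV2 ?posrE ?exprn_gt0// ler_weXn2l.
  have sV0 r : 0 <= (s ^+ r)^-1 by rewrite invr_ge0 exprn_ge0// ltW.
  have Xy t : delta <= t <= 1 - delta -> `|X t - y t| <= `|C2| * (s ^+ 2)^-1.
    move=> tI; rewrite -(trajE phiC hdelta yt tI).
    have := traj1 t; rewrite /= in_itv /= => /(_ tI) /le_trans; apply.
    apply: (@le_trans _ _ (`|C2| * (s ^+ (p + 1))^-1)).
      by rewrite ler_wpM2r// ler_norm.
    by rewrite ler_wpM2l// sV// addn1 ltnS (leq_trans _ hp).
  have C2s : `|C2| * (s ^+ 2)^-1 <= `|C2| / s.
    by rewrite ler_wpM2l// -[s^-1]expr1 exprVn sV.
  have endI : delta <= 1 - delta <= 1 - delta by rewrite lexx ltW.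
  have xy1 := Xy _ endI; rewrite -/be in xy1.
  set y1 := y (1 - delta) in xy1.
  have /andP[x0al _] : x0 M <= al <= x1 M.
    by rewrite -yt.2; apply: (is_traj_itv yt); rewrite lexx ltW.
  have /andP[_ y1x1] := is_traj_itv yt endI; rewrite -/y1 in y1x1.
  (* The trajectory error was relaxed to order [M^-2], which the rate [M^(-3/2)] of (b)
     dominates. *)
  have pw : (s ^+ 2)^-1 <= s `^ (- (3 / 2)).
    have -> : (s ^+ 2)^-1 = s `^ (- 2%:R) by rewrite powRN powR_mulrn// ltW.
    by apply: ler_powR => //; clear; lra.
  rewrite ger0_norm ?powR_ge0// in hb1.
  have {}hb1 := le_trans pw hb1.
  move: xy1; rewrite ler_norml => /andP[xy1 xy2].
  have r0 : 0 < (s ^+ 2)^-1 by rewrite invr_gt0 exprn_gt0.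
  have e2C : e2 * (2 * (`|C2| + 1)) = 1.
    by rewrite /e2 mulVf// gt_eqF// mulr_gt0// ltr_wpDl.
  have C2n := normr_ge0 C2.
  (* (b) only bounds the absolute value of the minimum; it is positive since
     [y] stays in [D_0] and is close to [X] *)
  have mnlow : - (`|C2| * (s ^+ 2)^-1) <= Num.min (x1 M - be) (al - x0 M).
    rewrite le_min; apply/andP; split; first by clear - y1x1 xy2; lra.
    by apply: (@le_trans _ _ 0); [rewrite oppr_le0 mulr_ge0|rewrite subr_ge0].
  have mn0 : 0 < Num.min (x1 M - be) (al - x0 M).
    rewrite ltNge; apply/negP => mneg; move: hb1; rewrite ler0_norm// => hb1.
    have : (s ^+ 2)^-1 <= e2 * (`|C2| * (s ^+ 2)^-1).
      by apply: le_trans hb1 _; rewrite ler_wpM2l ?(ltW e20)// lerNl.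
    rewrite mulrA -{1}[(s ^+ 2)^-1]mul1r ler_pM2r// leNgt => /negP; apply.
    by clear - e20 e2C; lra.
  rewrite gtr0_norm// in hb1.
  have mnge : 2 * (`|C2| + 1) * (s ^+ 2)^-1 <= Num.min (x1 M - be) (al - x0 M).
    have D1 : 0 < 2 * (`|C2| + 1) by rewrite mulr_gt0// ltr_wpDl.
    have := ler_wpM2l (ltW D1) hb1; rewrite mulrA (mulrC _ e2) e2C mul1r.
    by [].
  have {mnlow mn0} x0al' : x0 M < al.
    by move: mn0; rewrite lt_min => /andP[_]; rewrite subr_gt0.
  have y1x : y1 < x1 M.
    have h1 : 2 * (`|C2| + 1) * (s ^+ 2)^-1 <= x1 M - be.
      by apply: le_trans mnge _; rewrite ge_min lexx.
    have h2 : 0 <= `|C2| * (s ^+ 2)^-1 by rewrite mulr_ge0.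
    by clear - h1 h2 xy1 r0; lra.
  (* [g_*] is controlled only up to [be], and the trajectory covers values only up to [y1]; the
     minimum satisfies both limits and is within [|C2| M^-2] of [be]. *)
  pose b := Num.min be y1.
  have b_be : b <= be by rewrite ge_min lexx.
  have b_y1 : b <= y1 by rewrite ge_min lexx orbT.
  have alb : al < b by rewrite lt_min albe /=; clear - n1 C2s xy2 albe; lra.
  have be_b : be - b <= `|C2| * (s ^+ 2)^-1.
    by rewrite /b; case: (leP be y1) => _; rewrite ?subrr ?mulr_ge0.
  have uI u : al <= u <= b -> u \in `[al, be].
    by move=> /andP[h1 h2]; rewrite inE /= in_itv /= h1 (le_trans h2 b_be).
  have uD u : al <= u <= b -> x0 M <= u <= x1 M.
    move=> /andP[h1 h2]; rewrite (le_trans x0al h1).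
    by rewrite (le_trans h2 (le_trans b_y1 y1x1)).
  have gG : forall u, `[al, be] u -> `|g u - gbeta (phi M) (bstar M) u| <= m / 2.
    move=> u /g1 /le_trans; apply; apply: le_trans n3.
    rewrite expr0 mul1r; apply: (@le_trans _ _ (`|C0| * (s ^+ p)^-1)).
      by rewrite ler_wpM2r// ler_norm.
    by rewrite ler_wpM2l// -[s^-1]expr1 exprVn sV// (leq_trans _ hp).
  have dgG : forall u, `[al, be] u -> `|derive1n 1 g u -
      deriven_within `[x0 M, x1 M] 1 (gbeta (phi M) (bstar M)) u| <= 1.
    move=> u /dg1 /le_trans; apply; apply: le_trans n4.
    have sp : s ^+ 1 / s ^+ p <= s^-1.
      have -> : s^-1 = s ^+ 1 * (s ^+ 2)^-1 by rewrite expr1 expr2; field; rewrite gt_eqF.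
      by rewrite ler_wpM2l ?sV ?exprn_ge0 ?ltW// (leq_trans _ hp).
    apply: (@le_trans _ _ (`|C1| * (s ^+ 1 / s ^+ p))).
      by rewrite ler_wpM2r ?ler_norm// mulr_ge0// ltW.
    by rewrite ler_wpM2l.
  apply: (HK M (x0 M) (x1 M) al b delta s (phi M) (bstar M) y) => //.
  - move=> u uab; have := gG u (set_mem (uI u uab)); rewrite ler_norml => /andP[h1 h2].
    have h3 : m <= g u by apply: gmin; have := uI u uab; rewrite inE.
    have h4 : g u <= N0.
      apply: le_trans (ler_norm _) (gN u _).
      by have := uI u uab; rewrite inE /= in_itv.
    by rewrite /cg /Cg; clear - h1 h2 h3 h4 N10 m0; apply/andP; split; lra.
  - move=> u uab; rewrite -(gbeta_derive_within (x01M) phiC _ (uD u uab)).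
    have h1 := dgG u (set_mem (uI u uab)).
    have h2 : `|derive1n 1 g u| <= N1.
      by apply: dgN; have := uI u uab; rewrite inE /= in_itv.
    move: h1 h2; rewrite /deriven_within /=; set A := derive1n 1 g u; set B := derive_within _ _ _.
    rewrite !ler_norml => /andP[h1 h2] /andP[h3 h4].
    by rewrite /Cg; clear - h1 h2 h3 h4 N00 m0; apply/andP; split; lra.
  - move=> u uab; have := phi1 u; rewrite /= in_itv /= => /(_ uab).
    move=> /(le_trans (ler_norm _)) /le_trans; apply.
    by rewrite muln0 addn0 expr1 ler_wpM2r ?ler_norm// ltW.
  - move=> u uab; have := dphi1 u; rewrite /= in_itv /= => /(_ uab).
    move=> /(le_trans (ler_norm _)) /le_trans; apply.
    by rewrite ler_wpM2r ?ler_norm// exprn_ge0// ltW.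
  - move=> k; apply: le_trans (supp1 k) _; rewrite lee_fin ler_wpM2r ?ler_norm//.
    by rewrite invr_ge0 ltW.
  - by move=> a /(A2v M M0)/andP[].
  have sVp : 0 < s^-1 by rewrite invr_gt0.
  rewrite (gtr0_norm sVp) in ha1.
  have := le_trans (ler_norm _) ha1; rewrite ge_max => /andP[ha2 ha3].
  have a1 : al - x0 M <= e1 / s by apply: le_trans ha2; rewrite distrC ler_norm.
  have a2 : x1 M - be <= e1 / s by apply: le_trans ha3; rewrite ler_norm.
  have a3 : be - b <= e1 / s.
    by apply: le_trans be_b _; rewrite expr2 invfM mulrA ler_wpM2r// ltW.
  have B0n := normr_ge0 B0.
  have e1B : `|B0| * e1 <= cl / 8.
    have -> : cl / 8 = (`|B0| + 1) * e1 by rewrite /e1; field; rewrite gt_eqF// ltr_wpDl.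
    by rewrite ler_wpM2r ?(ltW e10)// lerDl.
  apply: (@le_trans _ _ (`|B0| * s * (3 * (e1 / s)))).
    rewrite ler_wpM2l ?mulr_ge0 ?(ltW s0)//.
    by clear - a1 a2 a3; lra.
  have -> : `|B0| * s * (3 * (e1 / s)) = 3 * (`|B0| * e1) by field; rewrite gt_eqF.
  by clear - e1B cl0; lra.
split; first by apply: filterS key => M [].
apply/eqO_exP; exists K => //.
apply: filterS key => M [_ /andP[h1 h2]].
by rewrite ger0_norm// (ger0_norm (sqr_ge0 _)).
Unshelve. all: by end_near. Qed.
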